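(* (a) Suppose $F$ is a probability distribution on $[a,b]$, $a<b$, $a,b\in\mathbb{R}$, with mean $\mu$. Then for $p\in(0,1)$ and all $n\in\mathbb{N}$, $$n\mu\le \inf_{S\in\mathfrak S_n}\mathrm{ES}_p(S)\le n\mu+(b-a).$$ (b) Suppose $F$ is a probability distribution on $\mathbb{R}$ with mean $\mu$ and finite second moment. Then for $p\in(0,1)$ there is a constant $K$ that does not depend on $n$ (but possibly depends on $p$) such that for all $n\in\mathbb{N}$, $$n\mu\le \inf_{S\in\mathfrak S_n}\mathrm{ES}_p(S)\le n\mu+K.$$
   Context: All random variables are defined on a common atomless probability space $(\Omega,\mathcal A,\mathbb P)$, on which independent random vectors with any distributions can be generated. For a distribution $F$, $\mathfrak S_n=\{X_1+\cdots+X_n: X_i\sim F,\ i=1,\ldots,n\}$ (sums with arbitrary dependence). The Value-at-Risk is $\mathrm{VaR}_p(X)=\inf\{x:\mathbb P(X\le x)\ge p\}$, $p\in(0,1)$, and the Expected Shortfall is $\mathrm{ES}_p(X)=\frac{1}{1-p}\int_p^1\mathrm{VaR}_\alpha(X)\,d\alpha$, $p\in[0,1)$. *)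

(* Defs.v *)
From HB Require Import structures.
From mathcomp Require Import all_boot all_order all_algebra.
From mathcomp Require Import all_classical all_reals all_analysis.
Set Implicit Arguments.
Unset Strict Implicit.
Unset Printing Implicit Defensive.
Import Order.TTheory GRing.Theory Num.Theory.
Import numFieldNormedType.Exports.
Local Open Scope classical_set_scope.
Local Open Scope ring_scope.

Definition atomless (d : measure_display) (T : measurableType d) (R : realType)
    (P : probability T R) : Prop :=
  forall A : set T, measurable A -> (0 < P A)%E ->
    exists B : set T,
      [/\ measurable B, B `<=` A, (0 < P B)%E & (P B < P A)%E].

(* Laws are compared on Borel sets only: on other sets the values of a
   measure are unspecified. *)
Definition has_law (d : measure_display) (T : measurableType d) (R : realType)
    (P : probability T R) (X : {RV P >-> R})
    (F : probability (measurableTypeR R) R) : Prop :=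
  forall A : set (measurableTypeR R), measurable A -> distribution P X A = F A.

Definition admissible_sums (d : measure_display) (T : measurableType d)
    (R : realType) (P : probability T R)
    (F : probability (measurableTypeR R) R) (n : nat) : set {RV P >-> R} :=
  [set S | exists X : 'I_n -> {RV P >-> R},
     (forall i, has_law (X i) F) /\ forall w, S w = \sum_(i < n) X i w].

(* Meaningful for 0 < p < 1, where the set is nonempty and bounded below;
   outside this range [inf] may return a junk value. *)
Definition VaR (d : measure_display) (T : measurableType d) (R : realType)
    (P : probability T R) (p : R) (X : {RV P >-> R}) : R :=
  inf [set x : R | (p%:E <= cdf X x)%E].

(* Extended-real valued; the open interval discards only null sets and keeps
   the level inside the range 0 < alpha < 1 where [VaR] is meaningful. *)
Definition ES (d : measure_display) (T : measurableType d) (R : realType)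
    (P : probability T R) (p : R) (X : {RV P >-> R}) : \bar R :=
  (((1 - p)^-1)%:E *
     \int[lebesgue_measure]_(alpha in `]p, 1%R[) (VaR alpha X)%:E)%E.

Definition inf_ES (d : measure_display) (T : measurableType d) (R : realType)
    (P : probability T R) (F : probability (measurableTypeR R) R)
    (p : R) (n : nat) : \bar R :=
  ereal_inf [set ES p S | S in @admissible_sums d T R P F n].

(* Main.v *)
Require Import Defs.
From HB Require Import structures.
From mathcomp Require Import all_boot all_order all_algebra.
From mathcomp Require Import all_classical all_reals all_analysis.
From mathcomp Require Import measurable_realfun ring lra zify.
Import Order.TTheory GRing.Theory Num.Theory.
Import numFieldNormedType.Exports.
Local Open Scope classical_set_scope.
Local Open Scope ring_scope.

(** Splitting the atomless space again and again into halves produces, on every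
    event [E], a variable [U] that is uniform on ]0, 1] conditionally on [E].
    The lower bounds hold because VaR is nondecreasing in its level, so its mean
    over ]p, 1[ dominates its mean over ]0, 1[, which is the expectation.

    If a finite measure [nu] of mean [mu] lives on [a, b] and [G] is its quantile
    function, put [X i = G (U + i / n mod 1)].  As the rotated points are interlaced for
    any two values of [U], the sum [S] of the [X i] oscillates by at most [b - a]
    by monotonicity of [G]; averaging over [U] gives [S <= n mu + (b - a)].

    For the second part, cut the line into unit shells around [mu]: [N_k] on the
    left and [Q_l] on the right, with first absolute moments [m N_k], [m Q_l]
    around [mu] and common total [c].  The law is the sum over k, l of the measures
    [(m Q_l * F restricted to N_k + m N_k * F restricted to Q_l) / c], which have
    mean [mu] and live on intervals of length k + l + 2.  Partition the space into
    events carrying these measures and use the bounded construction on each: the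
    mean of the positive part of [S - n mu] is at most the sum of the masses times
    these lengths, which the second moment makes finite, independently of n.
    Finally ES exceeds [n mu] by at most that mean divided by [1 - p]. *)

(** * Sets of prescribed measure in an atomless space *)

Section atomless.
Context {R : realType} {d : measure_display} {T : measurableType d}.
Variable P : probability T R.
Implicit Types A B C E : set T.

Let p A : R := fine (P A).

Let pE A : measurable A -> P A = (p A)%:E.
Proof. by move=> mA; rewrite /p fineK// fin_num_measure. Qed.

Let p_ge0 A : 0 <= p A. Proof. exact: fine_ge0. Qed.

Let le_p A B : measurable A -> measurable B -> A `<=` B -> p A <= p B.
Proof. by move=> mA mB AB; rewrite -lee_fin -!pE// le_measure// inE. Qed.

Lemma prob_setD A B : measurable A -> measurable B -> B `<=` A ->
  P (A `\` B) = (P A - P B)%E.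
Proof.
move=> mA mB BA; rewrite measureD// ?setIidr//.
by rewrite -ge0_fin_numE ?fin_num_measure.
Qed.

Lemma prob_setU A B : measurable A -> measurable B -> A `&` B = set0 ->
  P (A `|` B) = (P A + P B)%E.
Proof. by move=> mA mB AB; rewrite measureU. Qed.

Let pD A B : measurable A -> measurable B -> B `<=` A -> p (A `\` B) = p A - p B.
Proof.
by move=> mA mB BA; rewrite /p prob_setD// fineB ?fin_num_measure.
Qed.

Let pU A B : measurable A -> measurable B -> A `&` B = set0 ->
  p (A `|` B) = p A + p B.
Proof.
by move=> mA mB AB; rewrite /p prob_setU// fineD ?fin_num_measure.
Qed.

Hypothesis hP : atomless P.

(** Of the two pieces that atomlessness provides, [B] and its complement in [A], one has at most
    half the mass. *)
Let halve A : measurable A -> 0 < p A ->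
  exists B, [/\ measurable B, B `<=` A, 0 < p B & p B <= p A / 2].
Proof.
move=> mA A0; have [|B [mB BA]] := hP A mA; first by rewrite pE// lte_fin.
rewrite !pE// !lte_fin => B0 BltA.
have [h|h] := leP (p B) (p A / 2); first by exists B.
exists (A `\` B); split; [exact: measurableD|exact: subDsetl| |].
  by rewrite pD// subr_gt0.
by rewrite pD//; lra.
Qed.

Let small_subset A (e : R) : measurable A -> 0 < p A -> 0 < e ->
  exists B, [/\ measurable B, B `<=` A, 0 < p B & p B <= e].
Proof.
move=> mA A0 e0.
have small k : exists B, [/\ measurable B, B `<=` A, 0 < p B & p B <= p A / 2 ^+ k].
  elim: k => [|k [B [mB BA B0 Bk]]]; first by exists A; split; rewrite ?expr0 ?divr1.
  have [C [mC CB C0 Ck]] := halve B mB B0; exists C; split=> //.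
    exact: subset_trans BA.
  apply: (le_trans Ck); rewrite exprSr invfM mulrA ler_pM2r//; lra.
have [k [_ Ak]] : exists k, True /\ p A / 2 ^+ k <= e.
  (* This exponent exceeds [p A / e], and [k < 2 ^ k]. *)
  exists (Num.truncn (p A / e)).+1; split => //.
  rewrite ler_pdivrMr ?exprn_gt0// mulrC -ler_pdivrMr//.
  apply/ltW/(lt_le_trans (truncnS_gt _)).
  by rewrite -natrX ler_nat ltnW// ltn_expl.
have [B [mB BA B0 Bk]] := small k.
by exists B; split => //; exact: le_trans Ak.
Qed.

(* Each step exhausts at least half of what can still be added, so the union of
   the steps leaves no admissible set of positive measure. *)
Lemma atomless_subset_measure A (s : R) : measurable A -> 0 <= s <= fine (P A) ->
  exists B, [/\ measurable B, B `<=` A & P B = s%:E].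
Proof.
move=> mA /andP[s0 sA]; rewrite -/(p A) in sA.
pose good B := [/\ measurable B, B `<=` A & p B <= s].
(* To a good set, [f] adds a piece with at least half the supremum of the masses that still fit
   under [s]. *)
have /choice[f fP] : forall B, exists B', good B -> [/\ good B', B `<=` B' &
    forall C, measurable C -> C `<=` A `\` B -> p C <= s - p B ->
      p C <= 2 * (p B' - p B)].
  move=> B; have [[mB BA Bs]|] := pselect (good B); last by exists set0.
  pose cand := [set C | [/\ measurable C, C `<=` A `\` B & p C <= s - p B]].
  pose V := p @` cand.
  have candS C : cand C -> p C <= sup V.
    move=> cC; apply: ub_le_sup; last by exists C.
    by exists (s - p B) => _ [D [_ _ ?] <-].
  have [C [cC hC]] : exists C, cand C /\ sup V <= 2 * p C.
    have c0 : cand set0.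
      by split => //; rewrite /p measure0/= subr_ge0.
    (* If the supremum is not positive the empty piece qualifies; otherwise some candidate has more
       than half of it. *)
    have [sV|sV] := leP (sup V) 0.
      by exists set0; split=> //; rewrite (le_trans sV)// mulr_ge0.
    have hV : has_sup V.
      split; first by exists (p set0), set0.
      by exists (s - p B) => _ [D [_ _ ?] <-].
    have /(_ _ hV)[|_ [C cC <-] hC] := @sup_adherent _ V (sup V / 2).
      by rewrite divr_gt0.
    by exists C; split => //; lra.
  have [mC CAB Cs] := cC.
  have pBC : p (B `|` C) = p B + p C.
    rewrite pU//; apply/seteqP; split=> // x [Bx /CAB[_]]; exact.
  exists (B `|` C) => _; split.
  - split; first exact: measurableU; last by rewrite pBC; lra.
    by move=> x [/BA//|/CAB[]].
  - exact: subsetUl.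
  - move=> D mD DAB Ds; have := candS D (And3 mD DAB Ds).
    by rewrite pBC; lra.
pose B n := iter n f set0.
have gB n : good (B n).
  by elim: n => [|n /fP[]//]; split; rewrite /= ?/p ?measure0.
have mB n : measurable (B n) by case: (gB n).
have ndB : {homo B : m n / (m <= n)%N >-> (m <= n)%O}.
  apply/nondecreasing_seqP => n; rewrite subsetEset.
  by have [_] := fP _ (gB n).
have mU : measurable (\bigcup_n B n) by exact: bigcupT_measurable.
exists (\bigcup_n B n); split => //; first by move=> x [n _]; case: (gB n) => _ + _; apply.
have BU n : p (B n) <= p (\bigcup_n B n) by apply: le_p => // x Bx; exists n.
have Us : p (\bigcup_n B n) <= s.
  rewrite -lee_fin -pE//.
  have cv := @nondecreasing_cvg_mu _ _ _ P B mB mU ndB.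
  rewrite -(cvg_lim _ cv)//; apply: lime_le; first by apply/cvg_ex; eexists; exact: cv.
  by near=> n => /=; rewrite pE// lee_fin; case: (gB n).
(* If mass were missing, one fixed set [C] of positive mass would remain available at every step.
   Each step would then add at least half of [p C], and the total would exceed [s]. *)
rewrite pE//; congr EFin; apply/eqP; rewrite eq_le Us/= leNgt; apply/negP => Ult.
have UA : \bigcup_n B n `<=` A by move=> x [n _]; case: (gB n) => _ + _; apply.
have [|||C [mC CA C0 Cs]] := @small_subset (A `\` \bigcup_n B n) (s - p (\bigcup_n B n)).
- exact: measurableD.
- by rewrite pD// subr_gt0 (lt_le_trans Ult).
- by rewrite subr_gt0.
have step n : p C <= 2 * (p (B n.+1) - p (B n)).
  have [_ _] := fP _ (gB n); apply => //.
    by move=> x /CA[Ax nUx]; split => // Bx; apply: nUx; exists n.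
  by rewrite (le_trans Cs)// lerB.
have grow n : n%:R * p C <= 2 * p (B n).
  elim: n => [|n ih]; first by rewrite mul0r mulr_ge0.
  by rewrite -natr1 mulrDl mul1r; have := step n; lra.
have := grow (Num.truncn (2 * s / p C)).+1; apply/negP; rewrite -ltNge.
rewrite -ltr_pdivrMr//; apply: le_lt_trans (truncnS_gt _).
by rewrite ler_pM2r ?invr_gt0// ler_pM2l//; case: (gB (Num.truncn (2 * s / p C)).+1).
Unshelve. all: by end_near. Qed.

End atomless.

(** * Uniform variables on an event, and partitions into prescribed masses *)

Section uniform.
Context {R : realType} {d : measure_display} {T : measurableType d}.
Variable P : probability T R.
Hypothesis hP : atomless P.
Implicit Types A B C E : set T.

Let atomless_between A B : measurable A -> measurable B -> A `<=` B ->
  exists C, [/\ measurable C, A `<=` C, C `<=` B &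
    fine (P C) = (fine (P A) + fine (P B)) / 2].
Proof.
move=> mA mB AB.
have mBA : measurable (B `\` A) by exact: measurableD.
have BA : fine (P (B `\` A)) = fine (P B) - fine (P A).
  by rewrite prob_setD// fineB ?fin_num_measure.
have AleB : fine (P A) <= fine (P B).
  by rewrite fine_le ?fin_num_measure// le_measure// inE.
have [|C [mC CBA PC]] :=
    atomless_subset_measure P hP (B `\` A) ((fine (P B) - fine (P A)) / 2) mBA.
  by rewrite BA; apply/andP; split; lra.
exists (A `|` C); split; [exact: measurableU|exact: subsetUl| |].
  by move=> x [/AB//|/CBA[]].
rewrite prob_setU//; last by apply/seteqP; split=> // x [Ax /CBA[_]]; exact.
by rewrite PC fineD ?fin_num_measure//=; lra.
Qed.

(** [L k j] is meant as the sublevel set at [j / 2 ^ k] of a uniform variable on [E]. Refinement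
    keeps the old sets at even indices and inserts sets of middle measure at odd ones. *)
Lemma atomless_dyadic_chain E : measurable E ->
  exists L : nat -> nat -> set T,
  [/\ forall k j, measurable (L k j) /\ L k j `<=` E,
      forall k j, L k j `<=` L k j.+1,
      forall k, L k 0%N = set0,
      forall k j, L k.+1 j.*2 = L k j &
      forall k j, (j <= 2 ^ k)%N -> fine (P (L k j)) = j%:R / 2 ^+ k * fine (P E)].
Proof.
move=> mE.
(* The choice of a middle set is made total, so that the recursion defining [L] carries no
   proofs. *)
have /choice[M MP] : forall AB : set T * set T, exists C,
    measurable AB.1 -> measurable AB.2 -> AB.1 `<=` AB.2 ->
    [/\ measurable C, AB.1 `<=` C, C `<=` AB.2 &
    fine (P C) = (fine (P AB.1) + fine (P AB.2)) / 2].
  move=> [A B]; have [[mA mB AB]|h] := pselect [/\ measurable A, measurable B & A `<=` B].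
    by have [C CP] := atomless_between A B mA mB AB; exists C.
  by exists set0 => mA mB AB; exfalso; exact: h.
(* Level 0 equals [E] for every [j >= 1], so nesting holds at all indices; only the measures require
   [j <= 2 ^ k]. *)
pose L := fix L (k j : nat) : set T := if k is k'.+1 then
    if odd j then M (L k' j./2, L k' j./2.+1) else L k' j./2
  else if j == 0%N then set0 else E.
have LP k : forall j, [/\ measurable (L k j), L k j `<=` E & L k j `<=` L k j.+1].
  elim: k => [|k ih] j /=; first by case: j => [|j] /=; split => //; exact: sub0set.
  have [m1 s1 i1] := ih j./2; have [m2 s2 i2] := ih j./2.+1.
  have [mM M1 M2 _] := MP (L k j./2, L k j./2.+1) m1 m2 i1.
  rewrite uphalf_half; case: ifPn => [oj|noj] /=.
    by rewrite add1n; split => //; exact: subset_trans s2.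
  by rewrite add0n; split.
exists L; split.
- by move=> k j; have [] := LP k j.
- by move=> k j; have [] := LP k j.
- by elim=> //= k ->.
- by move=> k j; rewrite /= odd_double doubleK.
- elim=> [|k ih] j jk /=.
    case: j jk => [|[|//]] _ /=; first by rewrite measure0 !mul0r.
    by rewrite expr0 divr1 mul1r.
  have hj : (j./2 <= 2 ^ k)%N.
    by rewrite -(doubleK (2 ^ k)%N) half_leq// -mul2n -expnS.
  have ej : j%:R = (odd j)%:R + 2 * j./2%:R :> R.
    by rewrite -{1}(odd_double_half j) natrD -mul2n natrM.
  case: ifPn => [oj|noj].
    have [m1 s1 i1] := LP k j./2; have [m2 s2 i2] := LP k j./2.+1.
    have [_ _ _ ->] := MP (L k j./2, L k j./2.+1) m1 m2 i1.
    have hj1 : (j./2.+1 <= 2 ^ k)%N.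
      by rewrite -ltn_double; move: jk; rewrite -{1}(odd_double_half j) oj add1n
        expnS mul2n.
    rewrite /= ih// ih// ej oj exprS -natr1 /=; field.
    by rewrite expf_neq0.
  rewrite ih// ej (negbTE noj) exprS/=; field.
  by rewrite expf_neq0.
Qed.

Lemma atomless_uniform E : measurable E ->
  exists U : T -> R, [/\ measurable_fun setT U, forall w, 0 < U w <= 1 &
    forall t, 0 <= t <= 1 -> P (E `&` [set w | U w <= t]) = (t%:E * P E)%E].
Proof.
move=> mE; have [L [mL L_mono L0 L_double PL]] := atomless_dyadic_chain E mE.
have ndL k i j : (i <= j)%N -> L k i `<=` L k j.
  elim: j => [|j ih]; first by rewrite leqn0 => /eqP->.
  rewrite leq_eqVlt => /orP[/eqP->//|/ih h]; exact: subset_trans (L_mono _ _).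
(* A point outside [L k j] should have a value of at least [j / 2 ^ k]; the variable is the supremum
   of these dyadic numbers. *)
pose D w : set R := [set x | exists k j, [/\ (j <= 2 ^ k)%N, ~ L k j w & x = j%:R / 2 ^+ k]].
have D0 w : D w 0 by exists 0%N, 0%N; split; rewrite ?L0 ?mul0r//; exact.
have D1 w : ubound (D w) 1.
  move=> _ [k [j [jk _ ->]]]; rewrite ler_pdivrMr ?exprn_gt0// mul1r.
  by rewrite -natrX ler_nat.
have Dsup w : has_sup (D w) by split; [exists 0|exists 1].
pose V w := sup (D w).
have V1 w : V w <= 1 by apply: ge_sup => //; exists 0.
have V0 w : 0 <= V w by apply: ub_le_sup => //; exists 1.
have ltV t w : t < V w <-> exists k j, [/\ (j <= 2 ^ k)%N, ~ L k j w & t < j%:R / 2 ^+ k].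
  split=> [/(sup_gt (ex_intro _ _ (D0 w)))[_ [k [j [jk Lw ->]]] tj]|[k [j [jk Lw tj]]]].
    by exists k, j.
  by apply: (lt_le_trans tj); apply: ub_le_sup; [exists 1|exists k, j].
have mV : measurable_fun setT V.
  apply: (measurability _ (RGenOInfty.measurableE R)) => _ [_ [t ->] <-].
  rewrite setTI (_ : _ @^-1` _ = \bigcup_k \bigcup_j
      ([set w | (j <= 2 ^ k)%N /\ t < j%:R / 2 ^+ k] `&` ~` L k j)); last first.
    apply/seteqP; split => w /=; rewrite in_itv/= andbT ltV.
      by move=> [k [j [? ? ?]]]; exists k => //; exists j.
    by move=> [k _ [j _ [[? ?] ?]]]; exists k, j.
  apply: bigcupT_measurable => k; apply: bigcupT_measurable => j.
  have [h|h] := pselect ((j <= 2 ^ k)%N /\ t < j%:R / 2 ^+ k).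
    rewrite (_ : [set _ | _] = setT) ?setTI; first by apply: measurableC; case: (mL k j).
    by apply/seteqP; split.
  rewrite (_ : [set _ | _] = set0) ?set0I//.
  by apply/seteqP; split.
have mVle t : measurable [set w | V w <= t].
  rewrite -[X in measurable X]setTI.
  rewrite (_ : [set w | _] = V @^-1` `]-oo, t]); first exact: mV.
  by apply/seteqP; split => w /=; rewrite in_itv.
have gtV t : 0 <= t < 1 ->
    P (E `&` [set w | t < V w]) = ((1 - t) * fine (P E))%:E.
  move=> /andP[t0 t1].
  (* [J k / 2 ^ k] is the first dyadic number of order [k] strictly above [t]. It decreases to [t],
     and the sets [G k] increase to the event. *)
  pose J k := (Num.truncn (t * 2 ^+ k)).+1.
  have J_gt k : t < (J k)%:R / 2 ^+ k.
    by rewrite ltr_pdivlMr ?exprn_gt0// truncnS_gt.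
  have J_le k : (J k)%:R / 2 ^+ k <= t + 2^-1 ^+ k.
    rewrite ler_pdivrMr ?exprn_gt0// mulrDl -exprMn mulVf// expr1n /J -natr1 lerD2r.
    by rewrite truncn_le// mulr_ge0// exprn_ge0.
  have Jk k : (J k <= 2 ^ k)%N.
    rewrite /J -ltnS; rewrite ltnS -(@ltr_nat R); apply: (@le_lt_trans _ _ (t * 2 ^+ k)).
      by rewrite truncn_le// mulr_ge0// exprn_ge0.
    by rewrite natrX -[ltRHS]mul1r ltr_pM2r// exprn_gt0.
  pose G k := E `\` L k (J k).
  have mG k : measurable (G k) by apply: measurableD => //; case: (mL k (J k)).
  have ndG : {homo G : m n / (m <= n)%N >-> (m <= n)%O}.
    apply/nondecreasing_seqP => k; rewrite subsetEset => w [Ew Lw]; split => // Lw'.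
    apply: Lw; rewrite -L_double; apply: ndL Lw'.
    rewrite /J truncn_lt_nat ?mulr_ge0 ?exprn_ge0// -mul2n natrM exprS mulrCA ltr_pM2l//.
    exact: truncnS_gt.
  have -> : E `&` [set w | t < V w] = \bigcup_k G k.
    apply/seteqP; split=> w /=.
      move=> [Ew /ltV[k [j [jk Lw tj]]]]; exists k => //; split => // Lw'.
      apply: Lw; apply: ndL Lw'; rewrite /J truncn_lt_nat ?mulr_ge0 ?exprn_ge0//.
      by rewrite -ltr_pdivlMr ?exprn_gt0.
    by move=> [k _ [Ew Lw]]; split => //; apply/ltV; exists k, (J k).
  have PG k : P (G k) = ((1 - (J k)%:R / 2 ^+ k) * fine (P E))%:E.
    have [mLk LE] := mL k (J k).
    rewrite prob_setD// -[P E]fineK ?fin_num_measure// -[P (L _ _)]fineK ?fin_num_measure//.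
    by rewrite PL//= -EFinB mulrBl mul1r.
  have mUG : measurable (\bigcup_k G k) by exact: bigcupT_measurable.
  have cv := @nondecreasing_cvg_mu _ _ _ P G mG mUG ndG.
  rewrite -(cvg_lim _ cv)//; apply: cvg_lim => //.
  rewrite (_ : _ \o _ = EFin \o (fun k => (1 - (J k)%:R / 2 ^+ k) * fine (P E))); last first.
    by apply/funext => k /=; rewrite PG.
  apply: cvg_EFin; first exact: nearW.
  apply: cvgMl; apply: cvgB; first exact: cvg_cst.
  apply: (@squeeze_cvgr _ _ _ _ (cst t) (fun k => t + 2^-1 ^+ k)).
  - by apply: nearW => k; rewrite J_le /cst ltW//; exact: J_gt.
  - exact: cvg_cst.
  - rewrite -[X in _ --> X]addr0; apply: cvgD; first exact: cvg_cst.
    by apply: cvg_expr; rewrite ger0_norm ?invr_ge0// invf_lt1// ltr1n.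
have leV t : 0 <= t <= 1 -> P (E `&` [set w | V w <= t]) = (t%:E * P E)%E.
  move=> /andP[t0]; rewrite le_eqVlt => /orP[/eqP->|t1].
    by rewrite mul1e; congr (P _); apply/seteqP; split => [w []|w Ew]//; split => //=.
  have h : P E = (P (E `&` [set w | (V w <= t)%R]) + P (E `&` [set w | (t < V w)%R]))%E.
    rewrite -[in LHS](setIT E) -(setUv [set w | (V w <= t)%R]) setIUr prob_setU.
    - congr (_ + P (_ `&` _))%E; apply/seteqP; split=> w /=; rewrite ?ltNge; first by move/negP.
      by move=> /negP.
    - exact: measurableI.
    - by apply: measurableI => //; exact: measurableC.
    - by rewrite setIACA setICr setI0.
  move: h; rewrite gtV ?t0//.
  rewrite -[P E]fineK ?fin_num_measure// -[P (E `&` _)]fineK ?fin_num_measure//; last first.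
    exact: measurableI.
  by rewrite -EFinD -EFinM => -[h]; congr EFin; lra.
(* [V] may vanish on a null part of [E]; the value 1 is put there because levels must be
   positive. *)
exists (fun w => if V w <= 0 then 1 else V w); split.
- apply: measurable_fun_ifT => //.
  apply: measurable_fun_ler => //.
- move=> w; case: (leP (V w) 0) => [|->]; by rewrite ?ltr01 ?lexx ?V1.
- move=> t /andP[t0]; rewrite le_eqVlt => /orP[/eqP->|t1].
    rewrite mul1e; congr (P _); apply/seteqP; split => [w []//|w Ew]; split => //=.
    by case: ifP.
  have -> : E `&` [set w | (if V w <= 0 then 1 else V w) <= t] =
      (E `&` [set w | V w <= t]) `\` (E `&` [set w | V w <= 0]).
    apply/seteqP; split => w /= [].
      by move=> Ew; case: ifPn => [_|h]; [rewrite leNgt t1|move=> h'; split=> // -[]].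
    by move=> [Ew Vt] h; split => //; case: ifPn => // V0'; exfalso; apply: h.
  have m1 : measurable (E `&` [set w | V w <= t]) by exact: measurableI.
  have m2 : measurable (E `&` [set w | V w <= 0]) by exact: measurableI.
  rewrite prob_setD//; last by move=> w /= [? /le_trans h]; split => //; exact: h.
  by rewrite leV ?t0 ?ltW// leV ?lexx ?ler01// mul0e sube0.
Qed.

(** Cut []0, 1]] at the cumulated fractions of the masses; the pieces are the events where [U] falls
    into the successive intervals. *)
Lemma atomless_partition E (q : nat -> \bar R) : measurable E ->
  (forall m, 0 <= q m)%E -> (\sum_(0 <= m <oo) q m = P E)%E ->
  exists A : nat -> set T, [/\ forall m, measurable (A m), trivIset setT A,
    \bigcup_m A m = E & forall m, P (A m) = q m].
Proof.
move=> mE q0 qE; have [U [mU U01 PU]] := atomless_uniform E mE.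
have mUle t : measurable [set w | U w <= t].
  rewrite -[X in measurable X]setTI.
  rewrite (_ : [set w | _] = U @^-1` `]-oo, t]); first exact: mU.
  by apply/seteqP; split => w /=; rewrite in_itv.
have q_le n : (\sum_(0 <= k < n) q k <= P E)%E.
  by rewrite -qE; apply: nneseries_lim_ge => k _ _; exact: q0.
have qfin k : q k \is a fin_num.
  rewrite ge0_fin_numE//; apply: (@le_lt_trans _ _ (P E)).
    by apply: le_trans (q_le k.+1); rewrite big_nat_recr//= leeDr// sume_ge0.
  by rewrite -ge0_fin_numE ?fin_num_measure.
pose e := fine (P E); pose s n := (\sum_(0 <= k < n) fine (q k)) / e.
have e0 : 0 <= e by exact: fine_ge0.
have sum_le n : \sum_(0 <= k < n) fine (q k) <= e.
  rewrite -lee_fin -sumEFin (eq_bigr q); last by move=> k _; rewrite fineK.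
  by rewrite /e fineK ?fin_num_measure.
have s01 n : 0 <= s n <= 1.
  rewrite divr_ge0//=; last by apply: sumr_ge0 => k _; exact: fine_ge0.
  move: e0; rewrite le_eqVlt => /orP[/eqP e0|e0]; first by rewrite /s -e0 invr0 mulr0.
  by rewrite ler_pdivrMr// mul1r.
have s_mono n : s n <= s n.+1.
  by rewrite /s big_nat_recr//= mulrDl lerDl divr_ge0// fine_ge0.
have s_nd m n : (m <= n)%N -> s m <= s n by move: m n; apply/nondecreasing_seqP.
pose G n := E `&` [set w | U w <= s n].
have mG n : measurable (G n) by exact: measurableI.
have GG n : G n `<=` G n.+1.
  by move=> w [Ew /= h]; split => //=; exact: le_trans (s_mono n).
pose C n := G n.+1 `\` G n.
have mC n : measurable (C n) by exact: measurableD.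
have CE n : C n `<=` E by move=> w [[]].
have PC n : P (C n) = q n.
  rewrite prob_setD// !PU// -[P E]fineK ?fin_num_measure// -!EFinM -EFinB -mulrBl.
  rewrite -[RHS]fineK//; congr EFin; rewrite /s big_nat_recr//= -mulrBl addrAC subrr add0r.
  (* On a null event the left side is zero, and the partial sums force [q n] to be zero too. *)
  rewrite -/e; have [e00|e_neq0] := eqVneq e 0; last by rewrite divfK.
  rewrite e00 mulr0; apply/eqP; rewrite eq_le fine_ge0//=.
  rewrite -e00; apply: le_trans (sum_le n.+1).
  by rewrite big_nat_recr//= lerDr sumr_ge0// => k _; exact: fine_ge0.
have CC m n w : C m w -> C n w -> (m <= n)%N.
  move=> [[_ /= Um] Um'] [[Ew /= Un] Un']; rewrite leqNgt; apply/negP => nm.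
  by apply: Um'; split => //=; exact: le_trans (s_nd _ _ nm).
have mUC : measurable (\bigcup_k C k.+1) by exact: bigcupT_measurable.
(* Piece 0 is what the other pieces leave, rather than [C 0], because the sets [C n] may miss a null
   part of [E]. *)
exists (fun m => if m is k.+1 then C k.+1 else E `\` \bigcup_k C k.+1); split.
- by case=> [|m]//; exact: measurableD.
- move=> [|m] [|n] _ _ [w []]//=.
  + by move=> [_ h] h'; exfalso; apply: h; exists n.
  + by move=> h' [_ h]; exfalso; apply: h; exists m.
  + by move=> h1 h2; apply/eqP; rewrite eqn_leq (CC _ _ w)//= (CC _ _ w).
- apply/seteqP; split => [w [[|m] _]|w Ew]; [by case|exact: CE|].
  have [[k _ Cw]|h] := pselect ((\bigcup_k C k.+1) w); first by exists k.+1.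
  by exists 0%N.
- case=> [|m]; last exact: PC.
  rewrite prob_setD//; last by move=> w [k _ /CE].
  have -> : P (\bigcup_k C k.+1) = (\sum_(k <oo) P (C k.+1))%E.
    apply: measure_semi_bigcup => //.
    move=> m n _ _ [w [h1 h2]]; apply/succn_inj/eqP.
    by rewrite eqn_leq (CC _ _ w)//= (CC _ _ w).
  under eq_eseriesr do rewrite PC -addn1.
  rewrite (nneseries_addn 1%N)// -qE nneseries_recl// addeK// ge0_fin_numE.
    apply: (@le_lt_trans _ _ (P E)).
      by rewrite -qE nneseries_recl// leeDr.
    by rewrite -ge0_fin_numE ?fin_num_measure.
  by apply: nneseries_ge0 => k _ _; exact: q0.
Qed.

End uniform.

(** * Value-at-Risk *)

Lemma measure_eq_rays (R : realType) (m1 m2 : {measure set R -> \bar R}) :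
  (m1 setT < +oo)%E -> (forall x, m1 `]-oo, x]%classic = m2 `]-oo, x]%classic)%E ->
  forall A, measurable A -> m1 A = m2 A.
Proof.
move=> m1oo m12 A mA; pose G : set (set R) := range (fun x : R => `]-oo, x]%classic).
apply: (@measure_unique _ R R G (fun k => `]-oo, k%:R]%classic)) => //.
- rewrite [LHS]RGenOInfty.measurableE eqEsubset; split.
    apply: smallest_sub; first exact: smallest_sigma_algebra.
    move=> _ [x ->]; rewrite -setCitvl.
    apply: sigma_algebraC; apply: sub_sigma_algebra; by exists x.
  rewrite -RGenOInfty.measurableE.
  apply: smallest_sub; first exact: smallest_sigma_algebra.
  by move=> _ [x _ <-]; exact: measurable_itv.
- move=> _ _ [x _ <-] [y _ <-]; exists (Num.min x y) => //.
  by apply/seteqP; split => z /=; rewrite !in_itv/= le_min => /andP.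
- by move=> k; exists k%:R.
- apply/seteqP; split => // x _; exists (Num.truncn x).+1 => //=.
  by rewrite in_itv/= ltW// truncnS_gt.
- by move=> _ [x _ <-].
- by move=> k; apply: le_lt_trans m1oo; rewrite le_measure// inE.
Qed.

Section VaR.
Context {R : realType} {d : measure_display} {T : measurableType d}.
Variables (P : probability T R) (X : {RV P >-> R}).

(** Right continuity of the cdf puts the infimum itself into the set. Asking for a witness, rather
    than [a < 1], admits level 1 for laws bounded above. *)
Lemma VaR_le (a x : R) : 0 < a -> (exists y, a%:E <= cdf X y)%E ->
  VaR a X <= x <-> (a%:E <= cdf X x)%E.
Proof.
move=> a0 S0; set S := [set y | (a%:E <= cdf X y)%E] in S0.
(* The cdf tends to 0 at minus infinity and so drops below the positive level, which bounds the set
   from below. *)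
have [y0 Hy0] : exists y0, (cdf X y0 < a%:E)%E.
  have : \forall y \near -oo%R, (cdf X y < a%:E)%E.
    have /= := cvg_cdfNy0 X. move/(_ [set z | (z < a%:E)%E]). apply.
    by apply: open_nbhs_nbhs; split; [exact: open_ereal_lt_ereal|rewrite /= lte_fin].
  by move=> /filter_ex[y]; exists y.
have lbS : has_lbound S.
  exists y0 => y Sy; rewrite leNgt; apply/negP => yy0.
  have := le_lt_trans Sy (le_lt_trans (cdf_nondecreasing X (ltW yy0)) Hy0).
  by rewrite ltxx.
split=> [Vx|Sx]; last exact: ge_inf.
have right e : 0 < e -> (a%:E <= cdf X (x + e))%E.
  move=> e0; have [//|y Sy yx] := @inf_adherent _ S e e0.
  apply: (le_trans Sy); apply: cdf_nondecreasing.
  by rewrite (le_trans (ltW yx))// lerD2r.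
have cv := @cdf_right_continuous _ _ _ _ X x.
rewrite -(cvg_lim _ cv)//; apply: lime_ge; first by apply/cvg_ex; eexists; exact: cv.
near=> z; rewrite -(subrK x z) addrC right// subr_gt0.
by near: z; exact: nbhs_right_gt.
Unshelve. all: by end_near. Qed.

Context {d' : measure_display} {T' : measurableType d'}.
Variable U : T' -> R.
Hypothesis mU : measurable_fun setT U.
Hypothesis U_level : forall w, 0 < U w /\ exists y, ((U w)%:E <= cdf X y)%E.

Lemma VaR_comp_le (x : R) :
  [set w | VaR (U w) X <= x] = [set w | U w <= fine (cdf X x)].
Proof.
apply/seteqP; split => w /=; have [U0 Uex] := U_level w.
  move/(VaR_le _ _ U0 Uex); by rewrite -lee_fin fineK// fin_num_measure.
move=> h; apply/(VaR_le _ _ U0 Uex); by rewrite -[cdf X x]fineK ?lee_fin// fin_num_measure.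
Qed.

Lemma measurable_VaR_comp : measurable_fun setT (fun w => VaR (U w) X).
Proof.
apply: (measurability _ (RGenOInfty.measurableE R)) => _ [_ [x ->] <-].
rewrite setTI -setCitvl preimage_setC; apply: measurableC.
rewrite [X in measurable X](_ : _ = U @^-1` `]-oo, fine (cdf X x)]).
  by rewrite -[X in measurable X]setTI; exact: mU.
have := VaR_comp_le x; rewrite !predeqE => h w; exact: h.
Qed.

(** Inverse transform sampling, checked on rays, where [VaR_comp_le] turns the event into one about
    [U]. The measure is arbitrary so as to cover both Lebesgue measure on []0, 1[] and [P] on an
    event. *)
Lemma VaR_comp_law (m : {measure set T' -> \bar R}) (E : set T') :
  measurable E -> (m E < +oo)%E ->
  (forall t, 0 <= t <= 1 -> m (E `&` [set w | U w <= t]) = (t%:E * m E)%E) ->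
  forall A, measurable A ->
    m (E `&` [set w | A (VaR (U w) X)]) = (m E * distribution P X A)%E.
Proof.
move=> mE mEoo mUt A mA.
pose f : T' -> R := fun w => VaR (U w) X.
have mf : measurable_fun setT f by exact: measurable_VaR_comp.
have k0 : 0 <= fine (m E) by exact: fine_ge0.
pose k := NngNum k0.
have mEfin : m E \is a fin_num by rewrite ge0_fin_numE.
have := measure_eq_rays _ (pushforward (mrestr m mE) f) (mscale k (distribution P X)) _ _ _ mA.
move/(_ mf); rewrite /= /pushforward /mrestr /mscale/= fineK// [f @^-1` A `&` _]setIC; apply.
  by rewrite preimage_setT setTI.
move=> x.
rewrite setIC -/(cdf X x) -[cdf X x]fineK ?fin_num_measure// muleC -mUt; last first.
  by rewrite -!lee_fin fineK ?fin_num_measure// cdf_ge0 cdf_le1.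
congr (m (_ `&` _)); rewrite -VaR_comp_le; apply/seteqP; split => w /=; by rewrite in_itv.
Qed.

End VaR.

(** * Change of variables along the law of a function on an event *)

Section transfer.
Context {R : realType} {d : measure_display} {T : measurableType d}.
Variables (m : {measure set T -> \bar R}) (nu : {measure set R -> \bar R}).
Variables (E : set T) (f : T -> R).
Hypotheses (mE : measurable E) (mf : measurable_fun setT f).
Hypothesis law : forall A, measurable A -> m (E `&` f @^-1` A) = nu A.
Local Open Scope ereal_scope.

(** The image under [f] of [m] restricted to [E] is [nu], and the complement of [E] is null for this
    restriction. *)
Lemma ge0_integral_law (h : R -> \bar R) : measurable_fun setT h ->
  (forall x, 0 <= h x) -> \int[m]_(w in E) h (f w) = \int[nu]_x h x.
Proof.
move=> mh h0; have mhf : measurable_fun setT (h \o f) by exact: measurableT_comp.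
transitivity (\int[pushforward (mrestr m mE) f]_x h x); last first.
  by apply: eq_measure_integral => A mA _; rewrite /= /pushforward /= /mrestr setIC law.
rewrite [RHS]ge0_integral_pushforward// preimage_setT.
rewrite -(setUv E) ge0_integral_setU//=.
- rewrite [X in _ = _ + X]null_set_integral ?adde0//.
  + by apply: eq_measure_integral => A mA AE; rewrite /= /mrestr setIidl.
  + exact: measurableC.
  + exact: measurable_funTS.
  + by rewrite /= /mrestr setIC setICr measure0.
- exact: measurableC.
- by rewrite setUv.
- by rewrite disj_set2E setICr.
Qed.

Lemma integral_law (h : R -> \bar R) : measurable_fun setT h ->
  \int[m]_(w in E) h (f w) = \int[nu]_x h x.
Proof.
move=> mh; rewrite [LHS]integralE [RHS]integralE; congr (_ - _).
- rewrite -(ge0_integral_law h^\+)//; last exact: measurable_funepos.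
  by apply: eq_integral => w _; rewrite -[RHS]/((h^\+ \o f) w) -funepos_comp.
- rewrite -(ge0_integral_law h^\-)//; last exact: measurable_funeneg.
  by apply: eq_integral => w _; rewrite -[RHS]/((h^\- \o f) w) -funeneg_comp.
Qed.

Lemma integrable_law (h : R -> \bar R) : measurable_fun setT h ->
  m.-integrable E (fun w => h (f w)) <-> nu.-integrable setT h.
Proof.
move=> mh.
have e : \int[m]_(w in E) `|h (f w)| = \int[nu]_x `|h x|.
  apply: (ge0_integral_law (abse \o h)) => [|x]; last exact: abse_ge0.
  exact: measurableT_comp.
split=> /integrableP[_ H]; apply/integrableP; split=> //.
- by rewrite -e.
- by apply: measurable_funTS; exact: measurableT_comp.
- by rewrite e.
Qed.

End transfer.

(** * The quantile function on []0, 1[] as a variable with the law of [X] *)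

Section ES.
Context {R : realType} {d : measure_display} {T : measurableType d}.
Variables (P : probability T R) (X : {RV P >-> R}).
Local Notation leb := (@lebesgue_measure R).

(** Levels outside []0, 1[] are replaced by one half, since [measurable_VaR_comp] asks for valid
    levels everywhere. *)
Let level (a : measurableTypeR R) : R :=
  if (0 < (a : R)) && ((a : R) < 1) then a else 2^-1.

Let level_in a : `]0, 1[%classic a -> level a = a.
Proof. by rewrite /level /= in_itv/= => ->. Qed.

Let measurable_level : measurable_fun setT level.
Proof.
apply: measurable_fun_ifT => //.
by apply: measurable_and; apply: measurable_fun_ltr.
Qed.

Lemma cdf_ge_ex (a : R) : a < 1 -> exists y, (a%:E <= cdf X y)%E.
Proof.
move=> a1; have : \forall y \near +oo%R, (a%:E < cdf X y)%E.
  have /= := cvg_cdfy1 X; move/(_ [set z | (a%:E < z)%E]); apply.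
  by apply: open_nbhs_nbhs; split; [exact: open_ereal_gt_ereal|rewrite /= lte_fin].
by move=> /filter_ex[y /ltW]; exists y.
Qed.

Let level01 a : 0 < level a < 1.
Proof. by rewrite /level; case: ifPn => // _; rewrite invr_gt0 invf_lt1 ?ltr1n//= ltr0n. Qed.

Let level_ok a : 0 < level a /\ exists y, ((level a)%:E <= cdf X y)%E.
Proof. by have /andP[? ?] := level01 a; split => //; exact: cdf_ge_ex. Qed.

Let q (a : measurableTypeR R) : R := VaR (level a) X.

Let mq : measurable_fun setT q.
Proof. exact: measurable_VaR_comp. Qed.

(** Under Lebesgue measure on []0, 1[] the level itself is uniform, so inverse transform sampling
    applies. *)
Let q_law A : measurable A -> leb (`]0, 1[ `&` q @^-1` A) = distribution P X A.
Proof.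
move=> mA.
have l01 : leb `]0, 1[ = 1%E.
  by rewrite lebesgue_measure_itv/= lte_fin ltr01 oppr0 adde0.
have := VaR_comp_law P X level measurable_level level_ok leb `]0, 1[%classic.
rewrite /= l01 => /(_ _ _ _ A mA); rewrite mul1e; apply => //; first exact: ltey.
move=> t /andP[t0 t1]; rewrite mule1.
have [t1'|t1'] := ltP t 1.
  rewrite (_ : _ `&` _ = `]0, t]%classic).
    rewrite lebesgue_measure_itv/= lte_fin; case: ltP t0 => [_ _|]; first by rewrite oppr0 adde0.
    by move=> h1 h2; congr EFin; apply/eqP; rewrite eq_le h1 h2.
  apply/seteqP; split => a /=.
    by move=> [h]; rewrite level_in//; move: h; rewrite /= !in_itv/= => /andP[-> _].
  rewrite /= !in_itv/= => /andP[a0 at_].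
  have a1 : a < 1 by exact: le_lt_trans t1'.
  by rewrite a0 a1 level_in//= in_itv/= a0.
have -> : t = 1 by apply/eqP; rewrite eq_le t1 t1'.
rewrite setIidl// => a _ /=; apply: ltW; by have /andP[] := level01 a.
Qed.

Let VaRq a : `]0, 1[%classic a -> VaR a X = q a.
Proof. by move=> h; rewrite /q level_in. Qed.

Lemma ge0_integral_VaR (h : R -> \bar R) : measurable_fun setT h ->
  (forall x, 0 <= h x)%E ->
  (\int[leb]_(a in `]0%R, 1%R[) h (VaR a X) = \int[P]_w h (X w))%E.
Proof.
move=> mh h0; under eq_integral => a do rewrite inE => /VaRq ->.
rewrite (ge0_integral_law leb (distribution P X) _ q)//.
by rewrite ge0_integral_distribution.
Qed.

Lemma integrable_VaR : P.-integrable setT (EFin \o X) ->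
  leb.-integrable `]0, 1[ (fun a => (VaR a X)%:E).
Proof.
move=> iX; apply: (@eq_integrable _ _ _ leb _ _ (fun a => (q a)%:E)) => //.
  by move=> a; rewrite inE => /VaRq ->.
apply/(integrable_law leb (distribution P X) _ q _ _ _ EFin) => //.
by apply: integrable_pushforward.
Qed.

Lemma integral_VaR : P.-integrable setT (EFin \o X) ->
  (\int[leb]_(a in `]0%R, 1%R[) (VaR a X)%:E = \int[P]_w (X w)%:E)%E.
Proof.
move=> iX; under eq_integral => a do rewrite inE => /VaRq ->.
rewrite (integral_law leb (distribution P X) _ q _ _ _ EFin)//.
by rewrite integral_distribution.
Qed.

Lemma VaR_nondecreasing (a b : R) : 0 < a -> a <= b -> b < 1 -> VaR a X <= VaR b X.
Proof.
move=> a0 ab b1; apply/VaR_le => //.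
  by have [y hy] := cdf_ge_ex b b1; exists y; apply: le_trans hy; rewrite lee_fin.
apply: (@le_trans _ _ b%:E); first by rewrite lee_fin.
by apply/VaR_le => //; [exact: lt_le_trans ab|exact: cdf_ge_ex].
Qed.

End ES.

(** * Bounds on Expected Shortfall *)

Lemma integrable_cst_lty (R : realType) (d : measure_display) (T : measurableType d)
    (m : {measure set T -> \bar R}) (D : set T) (k : R) :
  measurable D -> (m D < +oo)%E -> m.-integrable D (fun=> k%:E).
Proof.
move=> mD Doo; apply: (measurable_bounded_integrable (f := fun=> k)) => //.
exact: bounded_cst.
Qed.

Section ES_bounds.
Context {R : realType} {d : measure_display} {T : measurableType d}.
Variables (P : probability T R) (X : {RV P >-> R}).
Local Notation leb := (@lebesgue_measure R).
Hypothesis iX : P.-integrable setT (EFin \o X).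
Variable p : R.
Hypothesis p01 : 0 < p < 1.

Let p_sub : `]p, 1[%classic `<=` (`]0, 1[%classic : set R).
Proof.
have /andP[p0 p1] := p01.
by apply: subset_itvr; rewrite bnd_simp ltW.
Qed.

Let leb_p1 : leb `]p, 1[%classic = (1 - p)%:E.
Proof. by rewrite lebesgue_measure_itv/= lte_fin; case/andP: p01 => _ ->. Qed.

Let iV : leb.-integrable `]p, 1[ (fun a => (VaR a X)%:E).
Proof. by apply: integrableS (integrable_VaR P X iX). Qed.

(** A quantile is at most [c] plus its positive excess over [c]. The integral of that excess over
    []p, 1[] is at most the one over []0, 1[], which is the mean excess of [X]. *)
Lemma ES_le (c C : R) : (\int[P]_w (Num.max (X w - c) 0)%:E <= C%:E)%E ->
  (ES p X <= (c + C / (1 - p))%:E)%E.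
Proof.
move=> hC; have /andP[p0 p1] := p01.
pose h (x : R) : \bar R := (Num.max (x - c) 0)%:E.
have mh : measurable_fun setT h.
  apply/measurable_EFinP; apply: measurable_maxr => //.
  exact: measurable_funB.
have h0 x : (0 <= h x)%E by rewrite lee_fin le_max lexx orbT.
have mhV : measurable_fun `]p, 1[ (fun a => h (VaR a X)).
  apply: (measurableT_comp mh).
  by apply/measurable_EFinP; exact: measurable_int iV.
have hV : (\int[leb]_(a in `]p, 1%R[) h (VaR a X) <= C%:E)%E.
  apply: le_trans hC; rewrite -(ge0_integral_VaR P X h mh h0).
  apply: ge0_subset_integral => //.
  apply: (measurableT_comp mh).
  by apply/measurable_EFinP; exact: measurable_int (integrable_VaR P X iX).
have ih : leb.-integrable `]p, 1[ (fun a => h (VaR a X)).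
  apply/integrableP; split => //.
  under eq_integral do rewrite gee0_abs//.
  by apply: le_lt_trans hV _; rewrite ltry.
have ic : leb.-integrable `]p, 1[ (fun _ => c%:E).
  by apply: integrable_cst_lty => //; rewrite /= leb_p1 ltry.
rewrite /ES.
have : (\int[leb]_(a in `]p, 1%R[) (VaR a X)%:E <= (c * (1 - p) + C)%:E)%E.
  apply: (@le_trans _ _ (\int[leb]_(a in `]p, 1%R[) (c%:E + h (VaR a X)))%E).
    apply: le_integral => //; first exact: integrableD.
    by move=> a _; rewrite /h -EFinD lee_fin -lerBlDl le_max lexx.
  rewrite integralD// integral_cst//= leb_p1 [leRHS]EFinD EFinM leeD2l//.
move=> hI; apply: (@le_trans _ _ ((1 - p)^-1%:E * (c * (1 - p) + C)%:E)%E).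
  by apply: lee_wpmul2l => //; rewrite lee_fin invr_ge0 subr_ge0 ltW.
rewrite -EFinM lee_fin mulrDr mulrC mulfK ?subr_eq0 ?gt_eqF// lerD2l mulrC//.
Qed.

(** The quantile [q] at level [p] separates the two ranges: it is at least the mean over []0, p]]
    and at most the mean over []p, 1[]. *)
Lemma mean_le_ES : (\int[P]_w (X w)%:E <= ES p X)%E.
Proof.
have /andP[p0 p1] := p01.
have iV0 := integrable_VaR P X iX.
have sub1 : `]0, p]%classic `<=` (`]0, 1[%classic : set R).
  by apply: subset_itvl; rewrite bnd_simp.
have iV1 : leb.-integrable `]0, p] (fun a => (VaR a X)%:E).
  by apply: integrableS iV0.
have leb_p : leb `]0, p]%classic = p%:E.
  by rewrite lebesgue_measure_itv/= lte_fin p0 oppr0 adde0.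
set q := VaR p X.
have I1 : (\int[leb]_(a in `]0%R, p]) (VaR a X)%:E <= (q * p)%:E)%E.
  have -> : (q * p)%:E = (\int[leb]_(a in `]0%R, p]) q%:E)%E.
    by rewrite integral_cst//= leb_p.
  apply: le_integral => //.
    by apply: integrable_cst_lty => //; rewrite /= leb_p ltry.
  move=> a; rewrite inE/= in_itv/= => /andP[a0 ap]; rewrite lee_fin.
  exact: VaR_nondecreasing.
have I2 : ((q * (1 - p))%:E <= \int[leb]_(a in `]p, 1%R[) (VaR a X)%:E)%E.
  have -> : (q * (1 - p))%:E = (\int[leb]_(a in `]p, 1%R[) q%:E)%E.
    by rewrite integral_cst//= leb_p1.
  apply: le_integral => //.
    by apply: integrable_cst_lty => //; rewrite /= leb_p1 ltry.
  move=> a; rewrite inE/= in_itv/= => /andP[a0 ap]; rewrite lee_fin.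
  by apply: VaR_nondecreasing => //; exact: ltW.
rewrite -(integral_VaR P X iX) /ES.
have U01 : `]0, 1[%classic = `]0, p] `|` `]p, 1[ :> set R.
  by apply: itv_bndbnd_setU; rewrite bnd_simp// ltW.
rewrite U01 in iV0 *; rewrite integral_setU//=; last 2 first.
- exact: measurable_int iV0.
- apply/disj_set2P/seteqP; split => // x [] /=; rewrite !in_itv/= => /andP[_ xp] /andP[px _].
  by have := le_lt_trans xp px; rewrite ltxx.
have /(_ (measurable_itv _)) := fun mI => integrable_fin_num mI iV.
have /(_ (measurable_itv _)) := fun mI => integrable_fin_num mI iV1.
move: I1 I2.
case: (\int[leb]_(a in `]0%R, p]) (VaR a X)%:E)%E => // i1.
case: (\int[leb]_(a in `]p, 1%R[) (VaR a X)%:E)%E => // i2.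
rewrite !lee_fin => I1 I2 _ _.
have s0 : 0 < 1 - p by rewrite subr_gt0.
rewrite -(ler_pM2l s0) mulrA divff ?gt_eqF// mul1r.
(* The claim reduces to [(1 - p) * i1 <= p * i2], and [p * (1 - p) * q] lies between the two
   sides. *)
nra.
Qed.

End ES_bounds.

(** * Rotation coupling of a bounded law *)

Section rotation.
Context {R : realType}.

(* The fundamental domain is ]0, 1] and not [0, 1[ because VaR at level 0 is a
   junk value. *)
Definition circle_rot (n i : nat) (u : R) : R :=
  if u + i%:R / n%:R <= 1 then u + i%:R / n%:R else u + i%:R / n%:R - 1.

Lemma circle_rot01 (n i : nat) (u : R) : (i < n)%N -> 0 < u <= 1 -> 0 < circle_rot n i u <= 1.
Proof.
move=> ltin /andP[u0 u1]; rewrite /circle_rot; case: ifPn => [->|]; last rewrite -ltNge => gt1.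
  by rewrite andbT ltr_wpDr.
rewrite subr_gt0 gt1/= lerBlDr lerD// ltW// ltr_pdivrMr ?ltr0n ?(leq_ltn_trans _ ltin)//.
by rewrite mul1r ltr_nat.
Qed.

(** Write [n.+1 * u = j + r]. Rotation by [i / n.+1] sends [u] to the point of index [i + j] modulo
    [n.+1] with the same remainder [r], so the terms are merely permuted. *)
Lemma sum_circle_rot (n : nat) (u : R) : 0 < u <= 1 ->
  exists2 r, 0 < r <= 1 & forall G : R -> R,
    \sum_(i < n.+1) G (circle_rot n.+1 i u) = \sum_(k < n.+1) G ((k%:R + r) / n.+1%:R).
Proof.
move=> /andP[u0 u1]; have n0 : 0 < n.+1%:R :> R by rewrite ltr0n.
have ex : exists j, n.+1%:R * u <= j.+1%:R by exists n; rewrite ler_piMr.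
(* [j] is the ceiling of [n.+1 * u] minus 1, which puts the remainder in []0, 1]]. *)
pose j := ex_minn ex.
have [uj j_lt jn] : [/\ n.+1%:R * u <= j.+1%:R, j%:R < n.+1%:R * u & (j <= n)%N].
  rewrite /j; case: ex_minnP => m um min_m; split => //.
    case: m um min_m => [|m] um min_m; first by rewrite mulr_gt0.
    by rewrite ltNge; apply/negP => /min_m; rewrite ltnn.
  by apply: min_m; rewrite ler_piMr.
exists (n.+1%:R * u - j%:R).
  by rewrite subr_gt0 j_lt/= lerBlDl natr1.
set r := _ - j%:R => G.
have r0 : 0 < r by rewrite subr_gt0.
have r1 : r <= 1 by rewrite lerBlDl natr1.
have uE : u = (j%:R + r) / n.+1%:R by rewrite /r addrC subrK mulrC mulKf// gt_eqF.
(* Addition in the ordinal type is modular, so adding [inord j] permutes the indices. *)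
have rotE (i : 'I_n.+1) : circle_rot n.+1 i u = (((i + inord j)%R : 'I_n.+1)%:R + r) / n.+1%:R.
  have -> : ((i + inord j)%R : 'I_n.+1) = ((i + j) %% n.+1)%N :> nat.
    by rewrite /= inordK ?ltnS.
  rewrite /circle_rot {1 2 3}uE -!mulrDl ler_pdivrMr// mul1r.
  have [ij|ij] := ltnP (i + j) n.+1.
    rewrite modn_small// ifT; first by rewrite natrD; congr (_ / _); ring.
    move: ij; rewrite -(ler_nat R) -natr1 natrD; lra.
  have e : ((i + j) %% n.+1 = i + j - n.+1)%N.
    by rewrite -{1}(subnK ij) modnDr modn_small//; have := ltn_ord i; lia.
  rewrite e natrB// natrD ifF; first by field; rewrite gt_eqF.
  apply/negbTE; rewrite -ltNge.
  move: ij; rewrite -(ler_nat R) natrD; lra.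
under eq_bigr do rewrite rotE.
rewrite [RHS](reindex_inj (addIr (inord j))) /=.
by apply: eq_bigr.
Qed.

Lemma circle_rot_sum_osc (G : R -> R) (a b : R) (n : nat) (u v : R) :
  a <= b ->
  (forall x, 0 < x <= 1 -> a <= G x <= b) ->
  (forall x y, 0 < x -> x <= y -> y <= 1 -> G x <= G y) ->
  0 < u <= 1 -> 0 < v <= 1 ->
  \sum_(i < n) G (circle_rot n i u) <= \sum_(i < n) G (circle_rot n i v) + (b - a).
Proof.
move=> ab Gab Gmono u01 v01; case: n => [|n].
  by rewrite !big_ord0 add0r subr_ge0.
have [r /andP[r0 r1] ->] := sum_circle_rot n u u01.
have [s /andP[s0 s1] ->] := sum_circle_rot n v v01.
have n0 : 0 < n.+1%:R :> R by rewrite ltr0n.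
have in01 (k : nat) (t : R) : (k <= n)%N -> 0 < t -> t <= 1 -> 0 < (k%:R + t) / n.+1%:R <= 1.
  move=> kn t0 t1; rewrite divr_gt0 ?ltr_wpDl//= ler_pdivrMr// mul1r -natr1.
  by rewrite lerD// ler_nat.
(* If [r <= s] the sums compare term by term. Otherwise term [k] for [r] is compared with term
   [k + 1] for [s]; the last term for [r] and the first for [s] stay unmatched and cost at most
   [b - a]. *)
have [rs|sr] := leP r s.
  apply: (@le_trans _ _ (\sum_(k < n.+1) G ((k%:R + s) / n.+1%:R))).
    apply: ler_sum => k _; apply: Gmono.
    - by have /andP[] := in01 k r (leq_ord k) r0 r1.
    - by rewrite ler_pM2r ?invr_gt0// lerD2l.
    - by have /andP[] := in01 k s (leq_ord k) s0 s1.
  by rewrite lerDl subr_ge0.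
rewrite big_ord_recr big_ord_recl /=.
have /andP[_ h1] := Gab _ (in01 n r (leqnn n) r0 r1).
have /andP[h2 _] := Gab _ (in01 0%N s (leq0n n) s0 s1).
have h3 : \sum_(i < n) G ((i%:R + r) / n.+1%:R) <=
    \sum_(i < n) G (((bump 0 i)%:R + s) / n.+1%:R).
  apply: ler_sum => k _; apply: Gmono.
  - by have /andP[] := in01 k r (ltnW (ltn_ord k)) r0 r1.
  - by rewrite ler_pM2r ?invr_gt0// /bump/= natrD; lra.
  - by have /andP[] := in01 (bump 0 k) s (ltn_ord k) s0 s1.
lra.
Qed.

Context {d : measure_display} {T : measurableType d}.
Variable P : probability T R.
Variables (E : set T) (U : T -> R).
Hypotheses (mE : measurable E) (mU : measurable_fun setT U).
Hypothesis U01 : forall w, 0 < U w <= 1.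
Hypothesis PU : forall t, 0 <= t <= 1 -> P (E `&` [set w | U w <= t]) = (t%:E * P E)%E.

Lemma measurable_circle_rot (n i : nat) : measurable_fun setT (circle_rot n i \o U).
Proof.
have mV : measurable_fun setT (fun w => U w + i%:R / n%:R) by exact: measurable_funD.
apply: measurable_fun_ifT => //; first exact: measurable_fun_ler.
exact: measurable_funB.
Qed.

Lemma circle_rot_uniform (n i : nat) (t : R) : (i < n)%N -> 0 <= t <= 1 ->
  P (E `&` [set w | circle_rot n i (U w) <= t]) = (t%:E * P E)%E.
Proof.
move=> ltin /andP[t0 t1]; rewrite /circle_rot; set c := i%:R / n%:R.
have n0 : 0 < n%:R :> R by rewrite ltr0n (leq_ltn_trans _ ltin).
have c0 : 0 <= c by rewrite divr_ge0.
have c1 : c <= 1 by rewrite ler_pdivrMr// mul1r ler_nat ltnW.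
have mUle s : measurable (E `&` [set w | U w <= s]).
  apply: measurableI => //; rewrite -[X in measurable X]setTI.
  rewrite (_ : [set w | _] = U @^-1` `]-oo, s]); first exact: mU.
  by apply/seteqP; split => w /=; rewrite in_itv.
have PUI s r : 0 <= s -> s <= r -> r <= 1 ->
    measurable (E `&` [set w | s < U w <= r]) /\
    P (E `&` [set w | s < U w <= r]) = ((r - s)%:E * P E)%E.
  move=> s0 sr r1.
  have -> : E `&` [set w | s < U w <= r] =
      (E `&` [set w | U w <= r]) `\` (E `&` [set w | U w <= s]).
    apply/seteqP; split => w /=.
      by move=> [Ew /andP[sw wr]]; split => // -[_]; rewrite leNgt sw.
    by move=> [[Ew wr] h]; split => //; rewrite wr andbT ltNge; apply/negP => h'; exact: h.
  split; first exact: measurableD.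
  rewrite prob_setD//; last by move=> w [Ew /= h]; split => //=; exact: le_trans sr.
  rewrite !PU ?s0 ?r1 ?(le_trans s0)// ?(le_trans sr)//.
  by rewrite -[P E]fineK ?fin_num_measure// -!EFinM -EFinB -mulrBl.
(* If [c <= t] the event is that [U] avoids []t - c, 1 - c]]; otherwise it is that [U] lies in []1 -
   c, 1 - c + t]]. *)
have [ct|tc] := leP c t.
  have -> : E `&` [set w | (if U w + c <= 1 then U w + c else U w + c - 1) <= t] =
      (E `&` [set w | U w <= t - c]) `|` (E `&` [set w | 1 - c < U w <= 1]).
    apply/seteqP; split => w /=; have /andP[_ U1] := U01 w.
      case: ifPn => [h [Ew ht]|h [Ew ht]]; [left|right]; split => //; first lra.
      by rewrite U1 andbT; move: h; rewrite -ltNge; lra.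
    move=> [[Ew h]|[Ew /andP[h _]]]; split => //.
      by rewrite ifT; lra.
    by rewrite ifF; [lra|apply/negbTE; rewrite -ltNge; lra].
  have [m1 p1] := PUI (1 - c) 1 ltac:(lra) ltac:(lra) ltac:(lra).
  rewrite prob_setU// ?p1 ?PU; last 2 first.
  - by apply/andP; split; lra.
  - apply/seteqP; split=> // w [[_ /= h1] [_ /andP[h2 _]]]; lra.
  by rewrite -[P E]fineK ?fin_num_measure// -!EFinM -EFinD; congr EFin; ring.
have -> : E `&` [set w | (if U w + c <= 1 then U w + c else U w + c - 1) <= t] =
    E `&` [set w | 1 - c < U w <= 1 + t - c].
  apply/seteqP; split => w /=; have /andP[U0 U1] := U01 w.
    case: ifPn => [h [Ew ht]|h [Ew ht]]; first lra.
    by split => //; move: h; rewrite -ltNge => h; apply/andP; split; lra.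
  move=> [Ew /andP[h1 h2]]; split => //.
  by rewrite ifF; [lra|apply/negbTE; rewrite -ltNge; lra].
have [_ ->] := PUI (1 - c) (1 + t - c) ltac:(lra) ltac:(lra) ltac:(lra).
by congr (_%:E * _)%E; ring.
Qed.

End rotation.

(** * Couplings of measures carried by a bounded interval *)

Section coupling.
Context {R : realType} {d : measure_display} {T : measurableType d}.
Variable P : probability T R.
Hypothesis hP : atomless P.

(** [nu] is a bare set function, so that sums of measures can be used without building a measure
    structure on them. *)
Definition coupling (E : set T) (nu : set R -> \bar R) (n : nat) (X : 'I_n -> T -> R) :=
  (forall i, measurable_fun setT (X i)) /\
  (forall i A, measurable A -> P (E `&` X i @^-1` A) = nu A).

(** [VaR] takes random variables; the identity gives access to the quantiles of a law. *)
Definition id_rv (F : probability R R) : {RV F >-> R} :=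
  HB.pack (fun x : R => x)
    (isMeasurableFun.Build _ _ R R (fun x : R => x) (@measurable_id _ R setT)).

(** The quantile function of the normalized measure is applied to the rotations of a uniform
    variable on [E]. The mean is expressed through [max (x - a) 0], equal to [x - a] on the support,
    because nonnegative integrands need no integrability conditions. *)
Lemma bounded_coupling (nu : {measure set R -> \bar R}) (a b mu : R) (E : set T) (n : nat) :
  a <= b -> nu (~` `[a, b]) = 0%E -> measurable E -> P E = nu setT ->
  (\int[nu]_x (Num.max (x - a) 0)%:E = (mu - a)%:E * nu setT)%E ->
  exists2 X, coupling E nu n X &
    0 < fine (P E) -> forall w, E w -> \sum_(i < n) X i w <= n%:R * mu + (b - a).
Proof.
move=> ab nuab mE PE nu_mean.
have PEfin : P E \is a fin_num by rewrite fin_num_measure.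
(* On a null event [nu] vanishes and any measurable variables will do. *)
have [PE0|PE_neq0] := eqVneq (P E) 0%E.
  exists (fun=> cst 0); last by rewrite PE0 ltxx.
  have nuT0 : nu setT = 0%E by rewrite -PE.
  split=> // i A mA; transitivity (0%E : \bar R).
    apply/eqP; rewrite -measure_le0 -PE0 le_measure ?inE//.
    by apply: measurableI => //; rewrite preimage_cst; case: ifPn.
  by apply/esym/eqP; rewrite -measure_le0 -nuT0 le_measure ?inE.
have nufin : nu setT \is a fin_num by rewrite -PE.
pose F : probability R R := mnormalize nu (dirac point).
have FE A : F A = (nu A * (fine (nu setT))^-1%:E)%E.
  by rewrite /F/= /mnormalize -PE (negbTE PE_neq0)/= ifF//;
    apply/negbTE; rewrite -ltey ltey_eq PEfin.
have PFE A : (P E * F A = nu A)%E.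
  rewrite FE muleA [(P E * _)%E]muleC -muleA PE -[X in (_ * (X * _))%E]fineK//.
  by rewrite -EFinM divff ?mule1// -PE fine_eq0.
have [U [mU U01 PU]] := atomless_uniform P hP E mE.
pose X := id_rv F.
have cdfE x : cdf X x = F `]-oo, x]%classic by [].
have Fab : F `[a, b]%classic = 1%E.
  have : (nu `[a, b]%classic + nu (~` `[a, b]))%E = nu setT.
    rewrite -measureU// ?setUv// ?setICr//; exact: measurableC.
  rewrite nuab adde0 => e; rewrite FE e -[X in (X * _)%E]fineK//.
  by rewrite -EFinM divff// -PE fine_eq0.
(* Level 1 is attained at [b], so [G] makes sense on all of []0, 1]]. *)
have cdf_b : (1%:E <= cdf X b)%E.
  by rewrite cdfE -Fab le_measure ?inE//; exact: subset_itvr.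
have lt_a x : x < a -> cdf X x = 0%E.
  move=> xa; rewrite cdfE; apply/eqP; rewrite -measure_le0.
  apply: (@le_trans _ _ (F (~` `[a, b]%classic))).
    rewrite le_measure ?inE//; first exact: measurableC.
    by move=> y /=; rewrite !in_itv/= => yx /andP[/(le_trans)/(_ yx)]; rewrite leNgt xa.
  by rewrite FE nuab mul0e.
have Vex v : 0 < v <= 1 -> exists y, (v%:E <= cdf X y)%E.
  by move=> /andP[_ v1]; exists b; apply: le_trans cdf_b; rewrite lee_fin.
pose G v := VaR v X.
have Gab v : 0 < v <= 1 -> a <= G v <= b.
  move=> v01; have /andP[v0 v1] := v01; apply/andP; split; last first.
    by apply/(VaR_le F X v b v0 (Vex v v01)); apply: le_trans cdf_b; rewrite lee_fin.
  rewrite leNgt; apply/negP => /lt_a.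
  have /(VaR_le F X v (G v) v0 (Vex v v01)) := lexx (G v).
  by move=> + e; rewrite e lee_fin leNgt v0.
have Gmono x y : 0 < x -> x <= y -> y <= 1 -> G x <= G y.
  move=> x0 xy y1.
  have y01 : 0 < y <= 1 by rewrite y1 (lt_le_trans x0).
  have x01 : 0 < x <= 1 by rewrite x0 (le_trans xy).
  apply/(VaR_le F X x (G y) x0 (Vex x x01)).
  apply: (@le_trans _ _ y%:E); first by rewrite lee_fin.
  by apply/(VaR_le F X y (G y) _ (Vex y y01)) => //; case/andP: y01.
pose Y (i : 'I_n) w := G (circle_rot n i (U w)).
have circle_rot_ok (i : 'I_n) w :
    0 < (circle_rot n i \o U) w /\ exists y, (((circle_rot n i \o U) w)%:E <= cdf X y)%E.
  have r01 := circle_rot01 n i (U w) (ltn_ord i) (U01 w).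
  by split; [case/andP: r01|exact: Vex].
have mrot (i : 'I_n) : measurable_fun setT (circle_rot n i \o U)
  by exact: measurable_circle_rot.
have mY i : measurable_fun setT (Y i).
  exact: (measurable_VaR_comp F X (circle_rot n i \o U) (mrot i) (circle_rot_ok i)).
have lawY i A : measurable A -> P (E `&` Y i @^-1` A) = nu A.
  move=> mA; rewrite -PFE.
  apply: (VaR_comp_law F X (circle_rot n i \o U) (mrot i) (circle_rot_ok i) P E) => //.
    by rewrite ltey_eq PEfin.
  by move=> t t01; exact: (circle_rot_uniform P E U mE mU U01 PU n i t (ltn_ord i) t01).
exists Y; first by split.
move=> PE0 w Ew; set e := fine (P E) in PE0.
have osc w' : \sum_(i < n) Y i w <= \sum_(i < n) Y i w' + (b - a).
  exact: (circle_rot_sum_osc G a b n (U w) (U w') ab Gab Gmono (U01 w) (U01 w')).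
have PEoo : (P E < +oo)%E by rewrite ltey_eq PEfin.
have iY i : P.-integrable E (EFin \o Y i).
  apply: measurable_bounded_integrable => //; first exact: measurable_funTS.
  exists (`|a| + `|b|); split; first exact: num_real.
  move=> M hM w' Ew' /=; have := Gab _ (circle_rot01 n i (U w') (ltn_ord i) (U01 w')).
  rewrite -/(Y i w') => /andP[h1 h2]; apply: le_trans (ltW hM).
  rewrite ler_norml; apply/andP; split.
    by have := ler_norm (- a); rewrite normrN; have := normr_ge0 b; lra.
  by have := ler_norm b; have := normr_ge0 a; lra.
have PEe : P E = e%:E by rewrite /e fineK.
have intY i : (\int[P]_(w' in E) (Y i w')%:E = (mu * e)%:E)%E.
  pose h (x : R) : \bar R := (Num.max (x - a) 0)%:E.
  have mh : measurable_fun setT h.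
    by apply/measurable_EFinP; apply: measurable_maxr => //; exact: measurable_funB.
  have h0 x : (0 <= h x)%E by rewrite lee_fin le_max lexx orbT.
  have hY w' : E w' -> h (Y i w') = ((Y i w')%:E - a%:E)%E.
    have /andP[aY _] := Gab _ (circle_rot01 n i (U w') (ltn_ord i) (U01 w')).
    by rewrite /h max_l ?subr_ge0.
  have := ge0_integral_law P nu E (Y i) mE (mY i) (lawY i) h mh h0.
  rewrite nu_mean -PE PEe; under eq_integral => w' do rewrite inE => /hY ->.
  rewrite integralB ?integral_cst//; last 2 first.
  - exact: iY.
  - exact: integrable_cst_lty.
  have := integrable_fin_num mE (iY i).
  rewrite /= PEe; case: (\int[P]_(w' in E) (Y i w')%:E)%E => // y _.
  by rewrite -!EFinM -EFinB => -[h1]; congr EFin; lra.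
have intS : P.-integrable E (fun w' => \sum_(i < n) (Y i w')%:E)%E.
  by apply: integrable_sum => // i _; exact: iY.
have ic k : P.-integrable E (fun=> k%:E) by exact: integrable_cst_lty.
(* The sum at the fixed [w] is compared with its average over [w'] in [E], where every variable has
   mean [mu]. *)
have : (\int[P]_(w' in E) (\sum_(i < n) Y i w)%:E <=
        \int[P]_(w' in E) (\sum_(i < n) (Y i w')%:E + (b - a)%:E))%E.
  apply: le_integral => //; first exact: integrableD.
  by move=> w' _; rewrite sumEFin -EFinD lee_fin.
rewrite integralD// integral_sum// !integral_cst//.
rewrite (eq_bigr (fun=> (mu * e)%:E)); last by move=> i _; exact: intY.
rewrite sumEFin sumr_const card_ord /= PEe -!EFinM -EFinD lee_fin.
by rewrite -mulrnAl -mulrDl ler_pM2r// mulr_natl.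
Qed.

End coupling.

(** * Gluing couplings *)

Section glue.
Context {R : realType} {d : measure_display} {T : measurableType d}.
Variable P : probability T R.
Hypothesis hP : atomless P.

Definition excess (mu : R) (n : nat) (X : 'I_n -> T -> R) (w : T) : \bar R :=
  (Num.max (\sum_(i < n) X i w - n%:R * mu) 0)%:E.

Lemma excess_ge0 mu n X w : (0 <= excess mu n X w)%E.
Proof. by rewrite lee_fin le_max lexx orbT. Qed.

Lemma measurable_excess mu n (X : 'I_n -> T -> R) :
  (forall i, measurable_fun setT (X i)) -> measurable_fun setT (excess mu n X).
Proof.
move=> mX; apply/measurable_EFinP; apply: measurable_maxr => //.
by apply: measurable_funB => //; exact: measurable_sum.
Qed.

(** Quantifying over all events of the right mass permits gluing; one [C] for every [n] yields a
    constant independent of [n]. *)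
Definition excess_controlled (nu : set R -> \bar R) (mu : R) (C : \bar R) :=
  forall E n, measurable E -> P E = nu setT ->
    exists2 X, coupling P E nu n X &
      (\int[P]_(w in E) excess mu n X w <= C)%E.

Lemma bounded_excess_controlled (nu : {measure set R -> \bar R}) (a b mu : R) :
  a <= b -> nu (~` `[a, b]) = 0%E ->
  (\int[nu]_x (Num.max (x - a) 0)%:E = (mu - a)%:E * nu setT)%E ->
  excess_controlled nu mu ((b - a)%:E * nu setT)%E.
Proof.
move=> ab nuab nu_mean E n mE PE.
have [X cX X_le] := bounded_coupling P hP nu a b mu E n ab nuab mE PE nu_mean.
exists X => //; have mex := measurable_excess mu n X (proj1 cX).
have [PE0|PE0] := eqVneq (P E) 0%E.
  rewrite null_set_integral//; last exact: measurable_funTS.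
  by rewrite -PE PE0 mule0.
have PE_gt0 : 0 < fine (P E).
  by rewrite lt_neqAle fine_ge0// eq_sym fine_eq0 ?fin_num_measure// PE0.
have -> : ((b - a)%:E * nu setT = \int[P]_(w in E) (b - a)%:E)%E.
  by rewrite integral_cst//= PE.
apply: ge0_le_integral => //.
- by move=> w _; exact: excess_ge0.
- exact: measurable_funTS.
- move=> w Ew; rewrite lee_fin ge_max subr_ge0 ab andbT lerBlDl.
  exact: X_le.
Qed.

Lemma excess_controlled_le nu mu C C' : (C <= C')%E ->
  excess_controlled nu mu C -> excess_controlled nu mu C'.
Proof.
by move=> CC' h E n mE PE; have [X cX X_le] := h E n mE PE; exists X => //; exact: le_trans CC'.
Qed.

(** Split [E] into events of masses [nu m setT] and use on each the variables that control [nu m];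
    laws and excesses add up. *)
Lemma excess_controlled_series (nu : nat -> set R -> \bar R) (nu_sum : set R -> \bar R)
    (mu : R) (C : nat -> \bar R) :
  (forall m, 0 <= nu m setT)%E ->
  (forall A, measurable A -> \sum_(0 <= m <oo) nu m A = nu_sum A)%E ->
  (forall m, excess_controlled (nu m) mu (C m)) ->
  excess_controlled nu_sum mu (\sum_(0 <= m <oo) C m)%E.
Proof.
move=> nu0 nuE cnu E n mE PE.
have [|A [mA tA UA PA]] := atomless_partition P hP E (fun m => nu m setT) mE nu0.
  by rewrite PE nuE.
have /choice[X XP] : forall m, exists X : 'I_n -> T -> R,
    coupling P (A m) (nu m) n X /\ (\int[P]_(w in A m) excess mu n X w <= C m)%E.
  by move=> m; have [X ? ?] := cnu m (A m) n (mA m) (PA m); exists X.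
(* The index of the piece containing [w], with default 0 outside [E], where only measurability
   matters. *)
pose idx w := xget 0%N [set m | A m w].
have idxE m w : A m w -> idx w = m.
  move=> Amw; apply: xget_unique => // k Akw.
  by apply/(tA _ _ I I); exists w.
have idx_out w : ~ E w -> idx w = 0%N.
  by move=> Ew; apply: xgetPN => k Akw; apply: Ew; rewrite -UA; exists k.
pose Y (i : 'I_n) w := X (idx w) i w.
have YE m i w : A m w -> Y i w = X m i w by move=> /idxE; rewrite /Y => ->.
have mX m i : measurable_fun setT (X m i) by case: (XP m) => -[].
have mY i : measurable_fun setT (Y i).
  pose B m := if m is k.+1 then A k else ~` E.
  have mB m : measurable (B m) by case: m => [|m] //=; exact: measurableC.
  have -> : setT = \bigcup_m B m.
    apply/seteqP; split => // w _; have [Ew|Ew] := pselect (E w); last by exists 0%N.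
    by move: Ew; rewrite -UA => -[k _ Akw]; exists k.+1.
  apply/measurable_fun_bigcup => // -[|m] /=.
    apply: (eq_measurable_fun (X 0%N i)); last exact: measurable_funTS.
    by move=> w; rewrite inE /Y => /idx_out ->.
  apply: (eq_measurable_fun (X m i)); last exact: measurable_funTS.
  by move=> w; rewrite inE => /YE ->.
exists Y.
  split => // i B mB; rewrite -nuE// -UA setI_bigcupl measure_semi_bigcup.
  - apply: eq_eseriesr => m _; have [[_ lawX] _] := XP m.
    rewrite -(lawX i)//; congr (P _); apply/seteqP.
    by split => w [Aw /=]; rewrite (YE m).
  - by move=> m; apply: measurableI => //; rewrite -[X in measurable X]setTI; exact: mY.
  - by apply: trivIset_setIr.
  - apply: bigcupT_measurable => m; apply: measurableI => //.
    by rewrite -[X in measurable X]setTI; exact: mY.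
rewrite -UA ge0_integral_bigcup//; last 2 first.
- by apply: measurable_funTS; exact: measurable_excess.
- by move=> w _; exact: excess_ge0.
apply: lee_nneseries => [m _ _|m _].
  by apply: integral_ge0 => w _; exact: excess_ge0.
have [_] := XP m; apply: le_trans; rewrite le_eqVlt; apply/orP; left; apply/eqP.
apply: eq_integral => w; rewrite inE => Aw.
by rewrite /excess; under eq_bigr => i _ do rewrite (YE m)//.
Qed.

End glue.

(** * Laws with finite second moment *)

(** This motivates the weight [(t + 1) ^ 2]: at distance [t >= k] from the mean it dominates [t],
    and [k + 1] times both 1 and [t]. *)
Lemma ler_weight (R : realFieldType) (k t : R) : 0 <= k -> k <= t ->
  [/\ t <= (t + 1) ^+ 2, k + 1 <= (t + 1) ^+ 2 & (k + 1) * t <= (t + 1) ^+ 2].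
Proof. by move=> k0 kt; rewrite expr2; split; nra. Qed.

(** As [K] and [L] are at least 1, [K + L <= 2 * K * L], and each resulting product splits into a
    factor below [v] and one below [v']. A product bound can be summed over the two families of
    shells separately. *)
Lemma ler_pair_bound (R : realFieldType) (K L f f' m m' v v' : R) :
  1 <= K -> 1 <= L -> 0 <= f -> 0 <= f' -> 0 <= m -> 0 <= m' ->
  K * f <= v -> K * m <= v -> L * f' <= v' -> L * m' <= v' ->
  (K + L) * (m' * f + m * f') <= 4 * (v * v').
Proof.
move=> K1 L1 f0 f'0 m0 m'0 fv mv f'v m'v.
have h1 : (K * f) * (L * m') <= v * v'.
  by apply: ler_pM => //; rewrite mulr_ge0//; lra.
have h2 : (K * m) * (L * f') <= v * v'.
  by apply: ler_pM => //; rewrite mulr_ge0//; lra.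
have KL : K + L <= 2 * (K * L).
  by have : 0 <= (K - 1) * (L - 1) by [rewrite mulr_ge0//; lra]; lra.
have s0 : 0 <= m' * f + m * f' by rewrite addr_ge0// mulr_ge0.
apply: (le_trans (ler_wpM2r s0 KL)).
have -> : 2 * (K * L) * (m' * f + m * f') =
  2 * (K * f * (L * m')) + 2 * (K * m * (L * f')) by ring.
lra.
Qed.

Section second_moment.
Context {R : realType} {d : measure_display} {T : measurableType d}.
Variable P : probability T R.
Hypothesis hP : atomless P.
Variables (F : probability R R) (mu : R).

Let w (x : R) : \bar R := ((`|x - mu| + 1) ^+ 2)%:E.
Let dev (x : R) : \bar R := `|x - mu|%:E.

Hypothesis w_fin : (\int[F]_x w x < +oo)%E.
Hypothesis F_centered : (\int[F]_x (x - mu)%:E = 0)%E.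

Let mdev : measurable_fun setT dev.
Proof.
apply/measurable_EFinP; apply: measurableT_comp => //; exact: measurable_funB.
Qed.

Let mw : measurable_fun setT w.
Proof.
apply/measurable_EFinP; apply: measurable_funX; apply: measurable_funD => //.
by apply: measurableT_comp => //; exact: measurable_funB.
Qed.

Let dev0 x : (0 <= dev x)%E. Proof. by rewrite lee_fin. Qed.
Let w0 x : (0 <= w x)%E. Proof. by rewrite lee_fin sqr_ge0. Qed.

Definition cell (S : set R) (k : nat) : set R :=
  S `&` [set x | k%:R <= `|x - mu| < k.+1%:R].

Let mcell S k : measurable S -> measurable (cell S k).
Proof.
move=> mS; apply: measurableI => //.
rewrite -[X in measurable X]setTI.
rewrite (_ : [set x | _] = (fun x : R => `|x - mu|) @^-1` `[k%:R, k.+1%:R[).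
  suff : measurable_fun setT (fun x : R => `|x - mu|) by apply.
  by apply: measurableT_comp => //; exact: measurable_funB.
by apply/seteqP; split => x /=; rewrite in_itv.
Qed.

Let tcell S : trivIset setT (cell S).
Proof.
move=> i j _ _ [x [[_ /= /andP[i1 i2]] [_ /andP[j1 j2]]]].
apply/eqP; rewrite eqn_leq -(ltnS i j) -(ltnS j i).
by rewrite -!(ltr_nat R) (le_lt_trans i1 j2) (le_lt_trans j1 i2).
Qed.

Let Ucell S : \bigcup_k cell S k = S.
Proof.
apply/seteqP; split => [x [k _ []]//|x Sx].
by exists (Num.truncn `|x - mu|) => //; split => //=; exact: truncn_itv.
Qed.

Let F_cells S A : measurable S -> measurable A ->
  (\sum_(0 <= k <oo) F (A `&` cell S k) = F (A `&` S))%E.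
Proof.
move=> mS mA; rewrite -[in RHS](Ucell S) setI_bigcupr measure_semi_bigcup//.
- by move=> k; apply: measurableI => //; exact: mcell.
- by apply: trivIset_setIl; exact: tcell.
- by apply: bigcupT_measurable => k; apply: measurableI => //; exact: mcell.
Qed.

Let int_cells S (h : R -> \bar R) : measurable S -> measurable_fun setT h ->
  (forall x, 0 <= h x)%E ->
  (\sum_(0 <= k <oo) \int[F]_(x in cell S k) h x = \int[F]_(x in S) h x)%E.
Proof.
move=> mS mh h0; rewrite -[in RHS](Ucell S) ge0_integral_bigcup//.
- by move=> k; exact: mcell.
- exact: measurable_funTS.
Qed.

Let int_fin S (h : R -> \bar R) : measurable S -> measurable_fun setT h ->
  (forall x, 0 <= h x <= w x)%E -> (\int[F]_(x in S) h x)%E \is a fin_num.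
Proof.
move=> mS mh hw; have h0 x : (0 <= h x)%E by case/andP: (hw x).
rewrite ge0_fin_numE; last by apply: integral_ge0 => x _.
apply: le_lt_trans w_fin; apply: (@le_trans _ _ (\int[F]_x h x)%E).
  by apply: ge0_subset_integral => //.
by apply: ge0_le_integral => // x _; case/andP: (hw x).
Qed.

Let dev_w x : (0 <= dev x <= w x)%E.
Proof. by rewrite dev0/= lee_fin; have [] := ler_weight _ 0 _ (lexx 0) (normr_ge0 (x - mu)). Qed.

Let f S : R := fine (F S).
Let m S : R := fine (\int[F]_(x in S) dev x)%E.
Let v S : R := fine (\int[F]_(x in S) w x)%E.

Let fE S : measurable S -> F S = (f S)%:E.
Proof. by move=> mS; rewrite /f fineK// fin_num_measure. Qed.
Let mE S : measurable S -> (\int[F]_(x in S) dev x = (m S)%:E)%E.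
Proof. by move=> mS; rewrite /m fineK// int_fin. Qed.
Let vE S : measurable S -> (\int[F]_(x in S) w x = (v S)%:E)%E.
Proof. by move=> mS; rewrite /v fineK// int_fin// => x; rewrite w0 lexx. Qed.

Let f0 S : 0 <= f S. Proof. exact: fine_ge0. Qed.
Let m0 S : 0 <= m S. Proof. by apply: fine_ge0; apply: integral_ge0 => x _. Qed.
Let v0 S : 0 <= v S. Proof. by apply: fine_ge0; apply: integral_ge0 => x _. Qed.

Let f_cell S k : measurable S -> k.+1%:R * f (cell S k) <= v (cell S k).
Proof.
move=> mS; have mc := mcell S k mS.
rewrite -lee_fin EFinM -fE// -vE// -integral_cst//.
apply: ge0_le_integral => //; [by move=> x _; rewrite lee_fin|exact: measurable_funTS|].
move=> x [_ /= /andP[kx _]]; rewrite lee_fin -natr1.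
by have [] := ler_weight _ _ _ (ler0n R k) kx.
Qed.

Let m_cell S k : measurable S -> k.+1%:R * m (cell S k) <= v (cell S k).
Proof.
move=> mS; have mc := mcell S k mS.
rewrite -lee_fin EFinM -mE// -vE// -ge0_integralZl//; last exact: measurable_funTS.
apply: ge0_le_integral => //.
- by move=> x _; rewrite mule_ge0.
- by apply: measurable_funTS; exact: measurable_funeM.
- exact: measurable_funTS.
move=> x [_ /= /andP[kx _]]; rewrite -EFinM lee_fin -natr1.
by have [] := ler_weight _ _ _ (ler0n R k) kx.
Qed.

Let N : set R := `]-oo, mu].
Let Q : set R := `]mu, +oo[.
Let mN : measurable N. Proof. exact: measurable_itv. Qed.
Let mQ : measurable Q. Proof. exact: measurable_itv. Qed.

Let NQ_cover : N `|` Q = setT.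
Proof.
by apply/seteqP; split => // x _; rewrite /N /Q /= !in_itv/= andbT; case: leP; [left|right].
Qed.

Let NQ_disj : N `&` Q = set0.
Proof.
apply/seteqP; split => // x []; rewrite /N /Q/= !in_itv/= andbT => h1 h2.
by have := le_lt_trans h1 h2; rewrite ltxx.
Qed.

(** The integral of [x - mu] is zero, so its contributions from [N] and [Q] cancel. *)
Let m_balanced : m N = m Q.
Proof.
have dN : (\int[F]_(x in N) (x - mu)%:E = - \int[F]_(x in N) dev x)%E.
  rewrite -integral_ge0N//; apply: eq_integral => x.
  rewrite inE /N/= in_itv/= => xmu.
  rewrite /dev ler0_norm ?subr_le0//. by rewrite opprK.
have dQ : (\int[F]_(x in Q) (x - mu)%:E = \int[F]_(x in Q) dev x)%E.
  apply: eq_integral => x; rewrite inE /Q/= in_itv/= andbT => xmu.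
  by rewrite /dev ger0_norm ?subr_ge0// ltW.
have := F_centered; rewrite -NQ_cover integral_setU//=.
- by rewrite dN dQ !mE// -EFinN -EFinD => -[h]; lra.
- by apply: measurable_funTS; apply/measurable_EFinP; exact: measurable_funB.
- exact/disj_set2P.
Qed.

(** * Decomposition of the law into balanced pairs of shells *)

Section nondegenerate.
Let c : R := m Q.
Hypothesis c_gt0 : 0 < c.

Let NQ0 (S : set R) : 0 <= m S / c. Proof. by rewrite divr_ge0//; exact: m0. Qed.

(** The weights are crossed so that both sides deviate from [mu] by the same
    [m (cell N k) * m (cell Q l) / c], with opposite signs. *)
Let nu (k l : nat) : {measure set R -> \bar R} :=
  measure_add (mscale (NngNum (NQ0 (cell Q l))) (mrestr F (mcell N k mN)))
              (mscale (NngNum (NQ0 (cell N k))) (mrestr F (mcell Q l mQ))).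

Let nuE k l A : nu k l A =
  ((m (cell Q l) / c)%:E * F (A `&` cell N k) + (m (cell N k) / c)%:E * F (A `&` cell Q l))%E.
Proof. exact: measure_addE. Qed.

Let int_nu k l (h : R -> \bar R) : measurable_fun setT h -> (forall x, 0 <= h x)%E ->
  (\int[nu k l]_x h x = (m (cell Q l) / c)%:E * \int[F]_(x in cell N k) h x +
                        (m (cell N k) / c)%:E * \int[F]_(x in cell Q l) h x)%E.
Proof.
move=> mh h0; rewrite /nu ge0_integral_measure_add// !ge0_integral_mscale//=.
have restr D (mD : measurable D) : (\int[mrestr F mD]_x h x = \int[F]_(x in D) h x)%E.
  apply/esym; apply: (ge0_integral_law F (mrestr F mD) D (fun x => x)) => // A mA.
  by rewrite /= /mrestr setIC preimage_id.
by rewrite !restr.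
Qed.

Let pair_controlled k l :
  excess_controlled P (nu k l) mu (4 / c * v (cell N k) * v (cell Q l))%:E.
Proof.
have mNk := mcell N k mN; have mQl := mcell Q l mQ.
set Nk := cell N k in mNk *; set Ql := cell Q l in mQl *.
have nuT : nu k l setT = ((m Ql * f Nk + m Nk * f Ql) / c)%:E.
  rewrite nuE !setTI !fE// -!EFinM -EFinD; congr EFin; by ring.
have N_in x : Nk x -> mu - k.+1%:R < x <= mu /\ `|x - mu| = mu - x.
  rewrite /Nk /cell/= /N/= in_itv/= => -[xmu /andP[_ h]]; move: h.
  by rewrite ler0_norm ?subr_le0// opprB => h; rewrite xmu andbT; split => //; lra.
have Q_in x : Ql x -> mu < x < mu + l.+1%:R /\ `|x - mu| = x - mu.
  rewrite /Ql /cell/= /Q/= in_itv/= andbT => -[xmu /andP[_ h]]; move: h.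
  by rewrite ger0_norm ?subr_ge0 ?ltW// => h; rewrite xmu/=; split => //; lra.
pose a := mu - k.+1%:R; pose b := mu + l.+1%:R.
have k0 : 0 < k.+1%:R :> R by rewrite ltr0n.
have l0 : 0 < l.+1%:R :> R by rewrite ltr0n.
pose h (x : R) : \bar R := (Num.max (x - a) 0)%:E.
have mh : measurable_fun setT h.
  by apply/measurable_EFinP; apply: measurable_maxr => //; exact: measurable_funB.
have h0 x : (0 <= h x)%E by rewrite lee_fin le_max lexx orbT.
(* [x - a] is [k.+1] minus the distance to [mu] on the left shell, and [k.+1] plus it on the right;
   the distances cancel in the weighted sum. *)
have hN : (\int[F]_(x in Nk) h x = (k.+1%:R * f Nk - m Nk)%:E)%E.
  have : (\int[F]_(x in Nk) h x + \int[F]_(x in Nk) dev x = (k.+1%:R * f Nk)%:E)%E.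
    rewrite -ge0_integralD//; [|exact: measurable_funTS..].
    rewrite EFinM -fE// -integral_cst//; apply: eq_integral => x.
    rewrite inE => /N_in[/andP[h1 h2]]; rewrite /dev /h => ->.
    by rewrite max_l ?subr_ge0 ?ltW// -EFinD; congr EFin; rewrite /a; ring.
  rewrite mE//; case: (\int[F]_(x in Nk) h x)%E => // y.
  by rewrite -EFinD => -[e]; congr EFin; lra.
have hQ : (\int[F]_(x in Ql) h x = (m Ql + k.+1%:R * f Ql)%:E)%E.
  rewrite EFinD -mE// EFinM -fE// -integral_cst// -ge0_integralD//.
  - apply: eq_integral => x; rewrite inE => /Q_in[/andP[h1 h2]]; rewrite /dev /h => ->.
    rewrite max_l /a; last by lra.
    by rewrite -EFinD; congr EFin; ring.
  - exact: measurable_funTS.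
  - by move=> x _; rewrite lee_fin.
apply: (@excess_controlled_le _ _ _ P _ _ ((b - a)%:E * nu k l setT)%E); last first.
  apply: bounded_excess_controlled => //.
  - by rewrite /a /b; lra.
  - rewrite nuE; have -> : ~` `[a, b]%classic `&` cell N k = set0.
      apply/seteqP; split => // x [h1 /N_in[/andP[h2 h3] _]]; apply: h1.
      by rewrite /= in_itv/= ltW//=; rewrite /b; lra.
    have -> : ~` `[a, b]%classic `&` cell Q l = set0.
      apply/seteqP; split => // x [h1 /Q_in[/andP[h2 h3] _]]; apply: h1.
      by rewrite /= in_itv/= [x <= b]ltW// andbT /a; lra.
    by rewrite !measure0 !mule0 adde0.
  - rewrite int_nu// -/Nk -/Ql hN hQ nuT -!EFinM -EFinD; congr EFin.
    by rewrite /a; field; rewrite gt_eqF.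
rewrite nuT -EFinM lee_fin.
have -> : b - a = k.+1%:R + l.+1%:R by rewrite /a /b; ring.
have := f_cell N k mN; have := m_cell N k mN; have := f_cell Q l mQ; have := m_cell Q l mQ.
rewrite -/Nk -/Ql.
move=> h1 h2 h3 h4.
have := ler_pair_bound _ k.+1%:R l.+1%:R (f Nk) (f Ql) (m Nk) (m Ql) (v Nk) (v Ql).
rewrite !ler1n => /(_ isT isT (f0 _) (f0 _) (m0 _) (m0 _) h4 h3 h2 h1) H.
rewrite mulrA (_ : 4 / c * v Nk * v Ql = 4 * (v Nk * v Ql) / c); last by ring.
by rewrite ler_pM2r// invr_gt0.
Qed.
Let sum_m S : measurable S -> (\sum_(0 <= k <oo) (m (cell S k))%:E = (m S)%:E)%E.
Proof.
move=> mS; rewrite -mE// -int_cells//; apply: eq_eseriesr => k _.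
by rewrite mE//; exact: mcell.
Qed.

Let sum_v S : measurable S -> (\sum_(0 <= k <oo) (v (cell S k))%:E = (v S)%:E)%E.
Proof.
move=> mS; rewrite -vE// -int_cells//; apply: eq_eseriesr => k _.
by rewrite vE//; exact: mcell.
Qed.

Let sum_m_scaled S (A : set R) : measurable S -> m S = c -> measurable A ->
  (\sum_(0 <= k <oo) (m (cell S k) / c)%:E * F A = F A)%E.
Proof.
move=> mS mSc mA; rewrite fE//.
rewrite (eq_eseriesr (g := fun k => ((f A / c)%:E * (m (cell S k))%:E)%E)); last first.
  by move=> k _; rewrite -!EFinM; congr EFin; ring.
rewrite nneseriesZl; last by move=> k _; rewrite lee_fin m0.
by rewrite sum_m// mSc -EFinM divfK// gt_eqF.
Qed.

Lemma nondegenerate_excess_controlled : exists C : R, excess_controlled P F mu C%:E.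
Proof.
(* The double series is summed one index at a time. This is the sum over [l]: the weights on the
   left shell add up to 1 and the right shells fill [Q]. *)
pose nu1 k (A : set R) := (F (A `&` cell N k) + (m (cell N k) / c)%:E * F (A `&` Q))%E.
have c_neq0 : c != 0 by rewrite gt_eqF.
have nu1_ok k : excess_controlled P (nu1 k) mu (4 / c * v (cell N k) * v Q)%:E.
  have -> : (4 / c * v (cell N k) * v Q)%:E =
      (\sum_(0 <= l <oo) (4 / c * v (cell N k) * v (cell Q l))%:E)%E.
    under eq_eseriesr do rewrite EFinM.
    by rewrite nneseriesZl ?sum_v// => l _; rewrite lee_fin.
  apply: (excess_controlled_series P hP (fun l => nu k l)) => //.
  move=> A mA; under eq_eseriesr do rewrite nuE.
    rewrite nneseriesD; last 2 first.
    - by move=> l _ _; rewrite mule_ge0// lee_fin; exact: NQ0.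
    - by move=> l _ _; rewrite mule_ge0// lee_fin; exact: NQ0.
    rewrite nneseriesZl// F_cells//; congr (_ + _)%E.
    have mAN : measurable (A `&` cell N k) by apply: measurableI => //; exact: mcell.
    by rewrite sum_m_scaled.
exists (4 / c * v N * v Q).
have -> : (4 / c * v N * v Q)%:E =
    (\sum_(0 <= k <oo) (4 / c * v (cell N k) * v Q)%:E)%E.
  rewrite mulrAC EFinM -sum_v// -nneseriesZl//; last by move=> l _; rewrite lee_fin.
  by apply: eq_eseriesr => k _; rewrite -EFinM mulrAC.
apply: (excess_controlled_series P hP nu1) => //.
- by move=> k; rewrite adde_ge0// mule_ge0// lee_fin divr_ge0// m0.
- move=> A mA; rewrite nneseriesD//; last first.
    by move=> k _ _; rewrite mule_ge0// lee_fin; exact: NQ0.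
  have mAQ : measurable (A `&` Q) by exact: measurableI.
  rewrite F_cells// sum_m_scaled// -measureU//; last 2 first.
  - exact: measurableI.
  - by rewrite setIACA NQ_disj setI0.
  by rewrite -setIUr NQ_cover setIT.
Qed.

End nondegenerate.

Lemma second_moment_excess_controlled : exists C : R, excess_controlled P F mu C%:E.
Proof.
(* If [m Q] is zero the law is the point mass at [mu], carried by the interval [[mu, mu]] of length
   0. *)
have := m0 Q; rewrite le_eqVlt => /orP[/eqP mQ0|]; last exact: nondegenerate_excess_controlled.
exists 0.
have dev_null : (\int[F]_x dev x = 0)%E.
  rewrite -NQ_cover ge0_integral_setU//.
  - by rewrite !mE// m_balanced -mQ0 adde0.
  - exact: measurable_funTS.
  - exact/disj_set2P.
have Fmu : F (~` `[mu, mu]) = 0%E.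
  have : ae_eq F setT dev (cst 0%E).
    apply/ae_eq_integral_abs => //.
    by under eq_integral do rewrite gee0_abs//.
  move=> [A [mA A0 subA]]; apply: (subset_measure0 _ mA _ A0) => //.
    by apply: measurableC; exact: measurable_itv.
  move=> x xmu; apply: subA => /= /(_ I) [/eqP]; rewrite normr_eq0 subr_eq0 => /eqP xE.
  by apply: xmu; rewrite /= in_itv/= xE lexx.
have -> : (0%:E = (mu - mu)%:E * F setT)%E by rewrite subrr mul0e.
apply: bounded_excess_controlled => //.
rewrite subrr mul0e; apply/eqP; rewrite eq_le; apply/andP; split.
  rewrite -dev_null; apply: ge0_le_integral => //.
  - by move=> x _; rewrite lee_fin le_max lexx orbT.
  - by apply/measurable_EFinP; apply: measurable_maxr => //; exact: measurable_funB.
  - by move=> x _; rewrite lee_fin ge_max ler_norm normr_ge0.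
by apply: integral_ge0 => x _; rewrite lee_fin le_max lexx orbT.
Qed.

End second_moment.

(** * Integrability and moments of the given law *)

Section law_on_R.
Context {R : realType}.
Variable F : probability (measurableTypeR R) R.

(* The same law seen on the canonical measurable structure of [R] instead of
   its alias [measurableTypeR R]. *)
Let idR (x : measurableTypeR R) : R := x.
Let idR_rv : {RV F >-> R} :=
  HB.pack idR
    (isMeasurableFun.Build _ _ (measurableTypeR R) R idR (@measurable_id _ (measurableTypeR R) setT)).
Definition lawR : probability R R := distribution F idR_rv.

Lemma lawRE A : lawR A = F A. Proof. by []. Qed.

Lemma integral_lawR (h : R -> \bar R) : measurable_fun setT h ->
  (\int[lawR]_x h x = \int[F]_x h x)%E.
Proof.
move=> mh; apply/esym; apply: (integral_law F lawR setT idR _ _ _ h mh) => //.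
  exact: measurable_id.
by move=> A mA; rewrite setTI.
Qed.

Context {mu : R}.
Hypothesis F_mean : ('E_F[id] = mu%:E)%E.

Lemma lawR_mean : (\int[lawR]_x x%:E = mu%:E)%E.
Proof. by rewrite integral_lawR// -F_mean unlock. Qed.

(** The expectation is a difference of integrals of the positive and negative parts. Extended
    subtraction gives a finite value only if both are finite. *)
Lemma lawR_integrable : lawR.-integrable setT EFin.
Proof.
have mE : measurable_fun [set: R] (@EFin R) by [].
have := lawR_mean; rewrite integralE.
have p0 : (0 <= \int[lawR]_x (EFin^\+ x))%E by apply: integral_ge0 => x _; exact: funepos_ge0.
have n0 : (0 <= \int[lawR]_x (EFin^\- x))%E by apply: integral_ge0 => x _; exact: funeneg_ge0.
move=> e; apply/integrableP; split => //.
have -> : (\int[lawR]_x `|x%:E| = \int[lawR]_x (EFin^\+ x) + \int[lawR]_x (EFin^\- x))%E.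
  rewrite -ge0_integralD//; [|exact: measurable_funepos|exact: measurable_funeneg].
  by apply: eq_integral => x _; rewrite -[LHS]/((abse \o EFin) x) fune_abse.
move: e p0 n0.
case: (\int[lawR]_x (EFin^\+ x))%E => [y| |]//; case: (\int[lawR]_x (EFin^\- x))%E => [z| |]//.
by rewrite -EFinD ltry.
Qed.

Lemma lawR_mean_shift (a : R) : (\int[lawR]_x (x - a)%:E = (mu - a)%:E)%E.
Proof.
have -> : (mu - a)%:E = (\int[lawR]_x x%:E - \int[lawR]_x a%:E)%E.
  by rewrite lawR_mean integral_cst//= lawRE probability_setT mule1.
rewrite -integralB//; first exact: lawR_integrable.
apply: integrable_cst_lty => //=; by rewrite lawRE probability_setT ltry.
Qed.

Lemma lawR_weight_lty : ('E_F[(fun x : R => x ^+ 2)%R] < +oo)%E ->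
  (\int[lawR]_x ((`|x - mu| + 1) ^+ 2)%:E < +oo)%E.
Proof.
have msq : measurable_fun setT (fun x : R => (x ^+ 2)%:E).
  by apply/measurable_EFinP; exact: measurable_funX.
rewrite unlock -(integral_lawR (fun x => (x ^+ 2)%:E))// => sq_fin.
(* The constant 3 comes from bounding the square of [|x| + |mu| + 1] by three times the sum of the
   squares. *)
apply: (@le_lt_trans _ _ (\int[lawR]_x (3%:E * (x ^+ 2)%:E + (3 * (mu ^+ 2 + 1))%:E))%E).
  apply: ge0_le_integral => //.
  - apply/measurable_EFinP; apply: measurable_funX; apply: measurable_funD => //.
    by apply: measurableT_comp => //; exact: measurable_funB.
  - by apply: emeasurable_funD => //; exact: measurable_funeM.
  - move=> x _; rewrite -EFinM -EFinD lee_fin.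
    apply: (@le_trans _ _ ((`|x| + `|mu| + 1) ^+ 2)).
      rewrite ler_pXn2r ?nnegrE ?addr_ge0// lerD2r.
      exact: ler_normB.
    rewrite -(real_normK (num_real x)) -(real_normK (num_real mu)) -subr_ge0.
    set y := `|x|; set z := `|mu|.
    have -> : 3 * y ^+ 2 + 3 * (z ^+ 2 + 1) - (y + z + 1) ^+ 2 =
       (y - z) ^+ 2 + (y - 1) ^+ 2 + (z - 1) ^+ 2 by ring.
    by rewrite !addr_ge0// sqr_ge0.
rewrite ge0_integralD//; last 3 first.
- by move=> x _; rewrite -EFinM lee_fin mulr_ge0// sqr_ge0.
- exact: measurable_funeM.
- by move=> x _; rewrite lee_fin mulr_ge0// addr_ge0// sqr_ge0.
rewrite ge0_integralZl//; last by move=> x _; rewrite lee_fin sqr_ge0.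
rewrite lte_add_pinfty//; first by rewrite lte_mul_pinfty.
by rewrite integral_cst//= lawRE probability_setT mule1 ltry.
Qed.

End law_on_R.

(** * Expected Shortfall of admissible sums *)

Section admissible_sums.
Context {R : realType} {d : measure_display} {T : measurableType d}.
Variables (P : probability T R) (F : probability (measurableTypeR R) R).
Variable mu : R.
Hypothesis F_mean : ('E_F[id] = mu%:E)%E.

Lemma admissible_sums_mean (n : nat) (S : {RV P >-> R}) : @admissible_sums _ _ _ P F n S ->
  P.-integrable setT (EFin \o S) /\ (\int[P]_w (S w)%:E = (n%:R * mu)%:E)%E.
Proof.
move=> [X [lawX SE]].
have lawX' i A : measurable A -> P (setT `&` X i @^-1` A) = lawR F A.
  by move=> mA; rewrite setTI; exact: lawX.
have mX i : measurable_fun setT (X i) by exact: measurable_funPT.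
have iX i : P.-integrable setT (fun w => (X i w)%:E).
  apply/(integrable_law P (lawR F) setT (X i) measurableT (mX i) (lawX' i) EFin) => //.
  exact: lawR_integrable F_mean.
have ES_ : (fun w => (S w)%:E) = (fun w => \sum_(i < n) (X i w)%:E)%E.
  by apply/funext => w; rewrite SE sumEFin.
split.
  by rewrite [_ \o _]ES_; apply: integrable_sum => // i _; exact: iX.
rewrite ES_ integral_sum//.
rewrite (eq_bigr (fun=> mu%:E)); last first.
  move=> i _; rewrite (integral_law P (lawR F) setT (X i) measurableT (mX i) (lawX' i) EFin)//.
  exact: lawR_mean.
by rewrite sumEFin sumr_const card_ord mulr_natl.
Qed.

Lemma mean_le_inf_ES (p : R) (n : nat) : 0 < p < 1 ->
  ((n%:R * mu)%:E <= inf_ES P F p n)%E.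
Proof.
move=> p01; apply: le_ereal_inf_tmp => _ [S /admissible_sums_mean[iS <-] <-].
exact: mean_le_ES.
Qed.

Lemma inf_ES_le (p : R) (n : nat) (X : 'I_n -> T -> R) (c C : R) : 0 < p < 1 ->
  coupling P setT (lawR F) n X ->
  (\int[P]_w (Num.max (\sum_(i < n) X i w - c) 0)%:E <= C%:E)%E ->
  (inf_ES P F p n <= (c + C / (1 - p))%:E)%E.
Proof.
move=> p01 [mX lawX] hC.
have mS : measurable_fun setT (fun w => \sum_(i < n) X i w) by exact: measurable_sum.
pose Xrv i : {RV P >-> R} := HB.pack (X i) (isMeasurableFun.Build _ _ T R (X i) (mX i)).
pose S : {RV P >-> R} := HB.pack (fun w => \sum_(i < n) X i w)
  (isMeasurableFun.Build _ _ T R (fun w => \sum_(i < n) X i w) mS).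
have adS : @admissible_sums _ _ _ P F n S.
  exists Xrv; split => // i A mA; rewrite -lawRE -(lawX i A mA) setTI//.
have [iS _] := admissible_sums_mean n S adS.
apply: le_trans (ES_le P S iS p p01 c C hC).
by apply: ereal_inf_lbound; exists S.
Qed.

End admissible_sums.

Theorem corollary3p3 (R : realType) (d : measure_display)
    (T : measurableType d) (P : probability T R) (hP : atomless P) :
  (forall (F : probability (measurableTypeR R) R) (a b mu : R),
     a < b -> F `[a, b]%classic = 1%E -> ('E_F[id] = mu%:E)%E ->
     forall p : R, 0 < p < 1 -> forall n : nat,
       ((n%:R * mu)%:E <= inf_ES P F p n)%E /\
       (inf_ES P F p n <= (n%:R * mu + (b - a))%:E)%E)
  /\
  (forall (F : probability (measurableTypeR R) R) (mu : R),
     ('E_F[id] = mu%:E)%E -> ('E_F[(fun x : R => x ^+ 2)%R] < +oo)%E ->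
     forall p : R, 0 < p < 1 ->
     exists K : R, forall n : nat,
       ((n%:R * mu)%:E <= inf_ES P F p n)%E /\
       (inf_ES P F p n <= (n%:R * mu + K)%:E)%E).
Proof.
split=> [F a b mu ab Fab F_mean p p01 n|F mu F_mean F_sq p p01].
  split; first exact: mean_le_inf_ES.
  have PT : P setT = lawR F setT by rewrite lawRE !probability_setT.
  have Fout : lawR F (~` `[a, b]) = 0%E.
    by rewrite probability_setC ?lawRE ?Fab ?subee//; exact: measurable_itv.
  have mean : (\int[lawR F]_x (Num.max (x - a) 0)%:E = (mu - a)%:E * lawR F setT)%E.
    rewrite lawRE probability_setT mule1 -(lawR_mean_shift F F_mean a).
    apply: ae_eq_integral => //.
    - by apply/measurable_EFinP; apply: measurable_maxr => //; exact: measurable_funB.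
    - by apply/measurable_EFinP; exact: measurable_funB.
    - exists (~` `[a, b]); split => //; first exact: measurableC.
      move=> x /=; apply: contra_not; rewrite in_itv/= => /andP[ax _] _.
      by rewrite max_l// subr_ge0.
  have [X cX X_le] := bounded_coupling P hP (lawR F) a b mu setT n
    (ltW ab) Fout measurableT PT mean.
  (* The excess over [n mu + (b - a)] vanishes, so [inf_ES_le] applies with [C = 0] and the division
     by [1 - p] leaves no trace. *)
  rewrite -[(n%:R * mu + (b - a))%R]addr0 -[X in _ + X](mul0r (1 - p)^-1).
  apply: (inf_ES_le P F mu F_mean p n X _ _ p01 cX).
  rewrite integral0_eq// => w _; rewrite max_r// subr_le0 X_le//.
  by rewrite probability_setT ltr01.
have [C hC] := second_moment_excess_controlled P hP (lawR F) mu
  (lawR_weight_lty F F_sq) (etrans (lawR_mean_shift F F_mean mu) (congr1 EFin (subrr mu))).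
(* [C] controls every [n] at once; the factor comes from averaging over the levels in []p, 1[]. *)
exists (C / (1 - p)) => n; split; first exact: mean_le_inf_ES.
have [|X cX X_le] := hC setT n measurableT; first by rewrite lawRE !probability_setT.
exact: (inf_ES_le P F mu F_mean p n X _ _ p01 cX X_le).
Qed.
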